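(* Let $(M,H)$ be an $n$-dimensional Carnot manifold with weight sequence $(w_1,\ldots,w_n)$, and let $(X_1,\ldots,X_n)$ be an $H$-frame near a point $a\in M$. A system of local coordinates is a system of privileged coordinates at $a$ adapted to $(X_1,\ldots,X_n)$ if and only if it arises from a local chart of the form $\phi\circ\psi_{\kappa(a)}\circ\kappa$, where $\kappa$ is a local chart near $a$ such that $\kappa(a)=0$, the map $\psi_{\kappa(a)}$ is the polynomial map defined in the context with respect to the local coordinates given by $\kappa$, and $\phi$ is a diffeomorphism near the origin $0\in\mathbb{R}^n$ such that $$\phi(x)=\hat\phi(x)+\operatorname{O}_w\left(\|x\|^{w+1}\right)\qquad\text{near }x=0,$$ where $\hat\phi(x)$ is a $w$-homogeneous polynomial diffeomorphism such that $\hat\phi'(0)=\operatorname{id}$.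
   Context: A Carnot manifold of step $r$ is a pair $(M,H)$, where $M$ is a smooth manifold and $H=(H_1,\ldots,H_r)$ is a filtration of subbundles $H_1\subset\cdots\subset H_r=TM$ such that Lie brackets of sections of $H_w$ and $H_{w'}$ are sections of $H_{w+w'}$ whenever $w+w'\le r$. With $n=\dim M$, its weight sequence is $w_j=\min\{w\in\{1,\ldots,r\}:\ j\le\operatorname{rk}H_w\}$, $j=1,\ldots,n$. An $H$-frame over an open set is a tangent frame $(X_1,\ldots,X_n)$ such that each $X_j$ is a section of $H_{w_j}$. For a finite sequence $I=(i_1,\ldots,i_k)$ in $\{1,\ldots,n\}$ set $X_I=X_{i_1}\cdots X_{i_k}$ and $\langle I\rangle=w_{i_1}+\cdots+w_{i_k}$. A smooth function $f$ near $a$ has order $\ge N$ at $a$ ($N$ a non-negative integer) if $X_If(a)=0$ whenever $\langle I\rangle<N$; it has order $N$ if moreover $X_If(a)\neq0$ for some $I$ with $\langle I\rangle=N$. Local coordinates centered at $a$ are linearly adapted at $a$ to $(X_1,\ldots,X_n)$ if, in these coordinates, $X_j(0)=\partial_j$ for $j=1,\ldots,n$. They are privileged coordinates at $a$ adapted to $(X_1,\ldots,X_n)$ if they are linearly adapted and, for every $k$, the coordinate function $x_k$ has order $w_k$ at $a$. For $\alpha\in\mathbb{N}_0^n$: $|\alpha|=\alpha_1+\cdots+\alpha_n$ and $\langle\alpha\rangle=w_1\alpha_1+\cdots+w_n\alpha_n$. Definition of $\psi_{\kappa(a)}$. In the coordinates given by $\kappa$ write $X_j=\sum_kb_{jk}(x)\partial_{x_k}$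 and $B(x)=(b_{jk}(x))$. The map $T(x)=(B(\kappa(a))^t)^{-1}(x-\kappa(a))$ is the unique affine change of coordinates giving coordinates centered at $a$ that are linearly adapted to $(X_1,\ldots,X_n)$. Let $\hat\psi$ be the unique change of coordinates which transforms the linearly adapted coordinates given by $T$ into privileged coordinates at $a$ adapted to $(X_1,\ldots,X_n)$ and has components of the form $x_k+\sum_{\langle\alpha\rangle<w_k,\,|\alpha|\ge2}a_{k\alpha}x^\alpha$, $a_{k\alpha}\in\mathbb{R}$ (such a map exists and is unique). Then $\psi_{\kappa(a)}=\hat\psi\circ T$. Set $t\cdot x=(t^{w_1}x_1,\ldots,t^{w_n}x_n)$ for $t\in\mathbb{R}$, $x\in\mathbb{R}^n$. A map $\phi:\mathbb{R}^n\to\mathbb{R}^n$ is $w$-homogeneous if $\phi(t\cdot x)=t\cdot\phi(x)$ for all $t\in\mathbb{R}$, $x\in\mathbb{R}^n$. A pseudo-norm is a continuous function $\|\cdot\|:\mathbb{R}^n\to[0,\infty)$, positive on $\mathbb{R}^n\setminus0$, with $\|t\cdot x\|=|t|\,\|x\|$, e.g. $\|x\|=\sum_j|x_j|^{1/w_j}$ (all pseudo-norms are equivalent); one is fixed. A smooth $\mathbb{R}^n$-valued map $\Theta=(\Theta_1,\ldots,\Theta_n)$ near $0$ is $\operatorname{O}_w(\|x\|^{w+m})$ if $\Theta_k(x)=\operatorname{O}(\|x\|^{w_k+m})$ near $x=0$ for every $k$.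
   Formalization: The formal theorem additionally requires φ'(0) = id; without it the ''if'' part fails, e.g. for weights (1,2) and φ(x) = (x_1+x_2, x_2), which is id + O_w(‖x‖^{w+1}) but does not preserve linearly adapted coordinates. *)

(* Defs.v *)
From HB Require Import structures.
From mathcomp Require Import all_boot all_order all_algebra.
From mathcomp Require Import all_classical all_reals all_analysis.

Set Implicit Arguments.
Unset Strict Implicit.
Unset Printing Implicit Defensive.

Import Order.TTheory GRing.Theory Num.Theory numFieldNormedType.Exports.

Local Open Scope classical_set_scope.
Local Open Scope ring_scope.

(** * Smooth maps between open subsets of Euclidean spaces *)

Section Smoothness.
Variable R : realType.

Definition partial (n : nat) (i : 'I_n) (f : 'rV[R]_n -> R) : 'rV[R]_n -> R :=
  fun x => 'D_(delta_mx 0 i) f x.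

Definition iter_partial (n : nat) (s : seq 'I_n) (f : 'rV[R]_n -> R) :=
  foldr (@partial n) f s.

(* C^oo on U; only meaningful when U is open. *)
Definition smooth_fun_on (n : nat) (U : set 'rV[R]_n) (f : 'rV[R]_n -> R) :=
  forall x, U x -> forall s : seq 'I_n,
    {for x, continuous (iter_partial s f)} /\
    forall i : 'I_n, derivable (iter_partial s f) x (delta_mx 0 i).

Definition smooth_map_on (n m : nat) (U : set 'rV[R]_n)
    (F : 'rV[R]_n -> 'rV[R]_m) :=
  forall k : 'I_m, smooth_fun_on U (fun x => F x 0 k).

Definition smooth_near (n : nat) (x : 'rV[R]_n) (f : 'rV[R]_n -> R) :=
  exists U, [/\ open U, U x & smooth_fun_on U f].

Definition diffeo_on (n : nat) (U V : set 'rV[R]_n)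
    (F : 'rV[R]_n -> 'rV[R]_n) :=
  exists G : 'rV[R]_n -> 'rV[R]_n,
    [/\ smooth_map_on U F, smooth_map_on V G,
        (forall x, U x -> V (F x) /\ G (F x) = x) &
        (forall y, V y -> U (G y) /\ F (G y) = y)].

Definition diffeo_near (n : nat) (x : 'rV[R]_n)
    (F : 'rV[R]_n -> 'rV[R]_n) :=
  exists U V, [/\ open U, open V, U x & diffeo_on U V F].

End Smoothness.

(** * Smooth manifolds *)

(* A homeomorphism between an open subset [cdom] of T and an open subset of
   R^n. [cmap] and [cinv] are total functions; their values outside [cdom] and
   its image are irrelevant. *)
Record chart (R : realType) (n : nat) (T : topologicalType) := Chart {
  cdom : set T ;
  cmap :> T -> 'rV[R]_n ;
  cinv : 'rV[R]_n -> T ;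
  _ : open cdom ;
  _ : open (cmap @` cdom) ;
  _ : forall p, cdom p -> cinv (cmap p) = p ;
  _ : forall p, cdom p -> {for p, continuous cmap} ;
  _ : forall p, cdom p -> {for cmap p, continuous cinv} }.

Definition chart_compatible (R : realType) (n : nat) (T : topologicalType)
    (c d : chart R n T) :=
  smooth_map_on (c @` (cdom c `&` cdom d)) (fun x => d (cinv c x)) /\
  smooth_map_on (d @` (cdom c `&` cdom d)) (fun x => c (cinv d x)).

Record manifold (R : realType) (n : nat) := Manifold {
  mspace :> topologicalType ;
  atlas : set (chart R n mspace) ;
  _ : hausdorff_space mspace ;
  _ : @second_countable mspace ;
  _ : forall p : mspace, exists2 c, atlas c & cdom c p ;
  _ : forall c d, atlas c -> atlas d -> chart_compatible c d ;
  _ : forall c, (forall d, atlas d -> chart_compatible c d) -> atlas c }.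

(** * Tangent vectors and vector fields *)

Section Tangent.
Variables (R : realType) (n : nat) (M : manifold R n).

(* Tangent vectors at p and vector fields act on all functions M -> R, but only
   their values on functions that are smooth near the point considered matter:
   two tangent vectors at p are the same when they agree on those. *)
Definition functional := (M -> R) -> R.
Definition operator := (M -> R) -> (M -> R).

Definition smooth_at (p : M) (f : M -> R) :=
  exists c, [/\ atlas c, cdom c p & smooth_near (c p) (fun x => f (cinv c x))].

Definition coord_deriv (c : chart R n M) (k : 'I_n) : operator :=
  fun f p => partial k (fun x => f (cinv c x)) (c p).

Definition tangent (p : M) (v : functional) :=
  exists c (b : 'I_n -> R), [/\ atlas c, cdom c p &
    forall f, smooth_at p f -> v f = \sum_(k < n) b k * coord_deriv c k f p].

Definition vector_field (U : set M) (X : operator) :=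
  forall p, U p -> exists c (b : 'I_n -> M -> R),
    [/\ atlas c, cdom c p, forall k, smooth_at p (b k) &
      \forall q \near p, forall f, smooth_at q f ->
        X f q = \sum_(k < n) b k q * coord_deriv c k f q].

Definition Lie_bracket (X Y : operator) : operator :=
  fun f p => X (Y f) p - Y (X f) p.

(* (v_1, ..., v_d) is a basis of the space E of tangent vectors at p. *)
Definition basis_at (p : M) (E : set functional) (d : nat)
    (v : 'I_d -> functional) :=
  (forall u, E u <-> exists l : 'I_d -> R,
     forall f, smooth_at p f -> u f = \sum_(i < d) l i * v i f) /\
  (forall l : 'I_d -> R,
     (forall f, smooth_at p f -> \sum_(i < d) l i * v i f = 0) ->
     forall i, l i = 0).

Definition field_at (X : operator) (p : M) : functional := fun f => X f p.

Definition subbundle (E : M -> set functional) (d : nat) :=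
  (forall p v, E p v -> tangent p v) /\
  forall p, exists (U : set M) (Y : 'I_d -> operator),
    [/\ open U, U p, forall i, vector_field U (Y i) &
        forall q, U q -> basis_at q (E q) (fun i => field_at (Y i) q)].

Definition section (E : M -> set functional) (U : set M) (X : operator) :=
  vector_field U X /\ forall p, U p -> E p (field_at X p).

End Tangent.

(** * Carnot manifolds *)

(* [filtr w], with 1 <= w <= step, is the subbundle H_w, of rank [rk w]; the values
   of [filtr] and [rk] at other arguments are irrelevant. *)
Record carnot_manifold (R : realType) (n : nat) := CarnotManifold {
  cman :> manifold R n ;
  step : nat ;
  filtr : nat -> cman -> set (functional cman) ;
  rk : nat -> nat ;
  _ : (0 < step)%N ;
  _ : forall w, (1 <= w <= step)%N -> subbundle (filtr w) (rk w) ;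
  _ : forall w, (1 <= w < step)%N -> forall p, filtr w p `<=` filtr w.+1 p ;
  _ : forall p, filtr step p = [set v | tangent p v] ;
  _ : forall w w', (0 < w)%N -> (0 < w')%N -> (w + w' <= step)%N ->
        forall (U : set cman) (X Y : operator cman), open U ->
          section (filtr w) U X -> section (filtr w') U Y ->
          section (filtr (w + w')) U (Lie_bracket X Y) }.

(* The indices of 'I_n start at 0, so that the condition j <= rk H_w on a
   1-based index j becomes a strict inequality. The condition holds for
   w = step, so that the default value of the minimum is attained. *)
Definition weight (R : realType) (n : nat) (M : carnot_manifold R n)
    (j : 'I_n) : nat :=
  \big[minn/step M]_(1 <= w < (step M).+1 | (j < rk M w)%N) w.

Definition H_frame (R : realType) (n : nat) (M : carnot_manifold R n)
    (U : set M) (X : 'I_n -> operator M) :=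
  (forall j, section (filtr (weight M j)) U (X j)) /\
  (forall p, U p -> basis_at p [set v | tangent p v] (fun j => field_at (X j) p)).

(** * Weighted homogeneity on R^n *)

Section Weights.
Variables (R : realType) (n : nat) (w : 'I_n -> nat).

Definition dilation (t : R) (x : 'rV[R]_n) : 'rV[R]_n :=
  \row_k (t ^+ w k * x 0 k).

Definition w_homogeneous (phi : 'rV[R]_n -> 'rV[R]_n) :=
  forall t x, phi (dilation t x) = dilation t (phi x).

Definition pseudo_norm (N : 'rV[R]_n -> R) :=
  [/\ continuous N, forall x, 0 <= N x, forall x, x != 0 -> 0 < N x &
      forall t x, N (dilation t x) = `|t| * N x].

Definition Ow (N : 'rV[R]_n -> R) (m : nat) (Theta : 'rV[R]_n -> 'rV[R]_n) :=
  forall k : 'I_n,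
    (fun x => Theta x 0 k) =O_ (0 : 'rV[R]_n) (fun x => N x ^+ (w k + m)).

End Weights.

(* For phi = hat_phi + O_w(||x||^(w+1)), tangent_to_id hat_phi does not imply
   tangent_to_id phi: for the weights (1, 2), the map
   (x_1, x_2) |-> (x_1 + x_2, x_2) is id + O_w(||x||^(w+1)), since x_2 is
   O(||x||^2), but its derivative at 0 is not the identity. *)
Definition tangent_to_id (R : realType) (n : nat)
    (phi : 'rV[R]_n -> 'rV[R]_n) :=
  'd phi (0 : 'rV[R]_n) = idfun :> ('rV[R]_n -> 'rV[R]_n).

Section Polynomials.
Variables (R : realType) (n : nat).

Definition mdeg (d : nat) (alpha : {ffun 'I_n -> 'I_d}) : nat :=
  (\sum_(i < n) alpha i)%N.

Definition wdeg (w : 'I_n -> nat) (d : nat) (alpha : {ffun 'I_n -> 'I_d}) :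
    nat :=
  (\sum_(i < n) w i * alpha i)%N.

Definition monomial (d : nat) (alpha : {ffun 'I_n -> 'I_d}) (x : 'rV[R]_n) : R :=
  \prod_(i < n) x 0 i ^+ alpha i.

Definition polynomial_map (F : 'rV[R]_n -> 'rV[R]_n) :=
  exists d (c : 'I_n -> {ffun 'I_n -> 'I_d} -> R),
    forall x k, F x 0 k = \sum_alpha c k alpha * monomial alpha x.

End Polynomials.

(** * Privileged coordinates *)

Section Privileged.
Variables (R : realType) (n : nat) (M : carnot_manifold R n).
Variables (a : M) (X : 'I_n -> operator M).

Local Notation w := (weight M).

Definition frame_word (I : seq 'I_n) : operator M :=
  fun f => foldr (fun i g => X i g) f I.

Definition word_weight (I : seq 'I_n) : nat := (\sum_(i <- I) w i)%N.

Definition order_ge (N : nat) (f : M -> R) :=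
  forall I, (word_weight I < N)%N -> frame_word I f a = 0.

Definition has_order (N : nat) (f : M -> R) :=
  order_ge N f /\ exists2 I, word_weight I = N & frame_word I f a != 0.

Definition linearly_adapted (c : chart R n M) :=
  c a = 0 /\
  forall j f, smooth_at a f -> X j f a = coord_deriv c j f a.

Definition privileged (c : chart R n M) :=
  linearly_adapted c /\ forall k, has_order (w k) (fun p => c p 0 k).

(* B is the matrix (b_jk) at the point a of the components of X_1, ..., X_n in
   the coordinates c. *)
Definition frame_matrix (c : chart R n M) (B : 'M[R]_n) :=
  forall j f, smooth_at a f ->
    X j f a = \sum_(k < n) B j k * coord_deriv c k f a.

(* (B^t)^-1 (x - x0) for column vectors becomes (x - x0) B^-1 for row vectors. *)
Definition affine_T (B : 'M[R]_n) (x0 x : 'rV[R]_n) : 'rV[R]_n :=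
  (x - x0) *m invmx B.

(* The weights lie in {1, ..., step}, so that every alpha with <alpha> < w_k has
   entries < step: the bound on the entries of alpha omits no monomial. *)
Definition hat_psi_form (psi : 'rV[R]_n -> 'rV[R]_n) :=
  exists c : 'I_n -> {ffun 'I_n -> 'I_(step M)} -> R, forall x k,
    psi x 0 k = x 0 k +
      \sum_(alpha | (wdeg w alpha < w k)%N && (2 <= mdeg alpha)%N)
        c k alpha * monomial alpha x.

(* psi is the map psi_(kappa(a)) attached to the chart kappa; such a map exists
   and is unique for every chart kappa at a. *)
Definition is_psi (kappa : chart R n M) (psi : 'rV[R]_n -> 'rV[R]_n) :=
  exists (B : 'M[R]_n) (hat_psi : 'rV[R]_n -> 'rV[R]_n),
    [/\ frame_matrix kappa B, hat_psi_form hat_psi,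
        (forall x, psi x = hat_psi (affine_T B (kappa a) x)) &
        exists c : chart R n M, [/\ atlas c, cdom c a,
          (\forall p \near a, c p = psi (kappa p)) & privileged c]].

End Privileged.

Definition admissible (R : realType) (n : nat) (w : 'I_n -> nat)
    (N : 'rV[R]_n -> R) (phi : 'rV[R]_n -> 'rV[R]_n) :=
  diffeo_near 0 phi /\
  exists hat_phi : 'rV[R]_n -> 'rV[R]_n,
    [/\ polynomial_map hat_phi, diffeo_on setT setT hat_phi,
        w_homogeneous w hat_phi, tangent_to_id hat_phi &
        Ow w N 1 (fun x => phi x - hat_phi x)].

(* Main.v *)
Require Import Defs.
From HB Require Import structures.
From mathcomp Require Import all_boot all_order all_algebra.
From mathcomp Require Import all_classical all_reals all_analysis.
From mathcomp Require Import ring lra zify.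
Import Order.TTheory GRing.Theory Num.Theory numFieldNormedType.Exports.
Local Open Scope classical_set_scope.
Local Open Scope ring_scope.

(* A chart [chi] that is already privileged is reached with [kappa = chi] and
   [psi = phi = id]. Conversely, [psi o kappa] is privileged near [a], so the
   point is that [phi] preserves privileged coordinates. Since [phi'(0) = id],
   linear adaptedness is preserved, and it also gives [X_k x_k (a) = 1], so that
   each coordinate reaches its weight. The component [phi_k] is
   [O(t^(w_k))] along every curve [t |-> t.x]. Expanding it as a Taylor
   polynomial plus a flat remainder, all monomials of weight less than [w_k]
   cancel, and a monomial of weight [m] in privileged coordinates has order at
   least [m] by the Leibniz rule; hence [phi_k] has order at least [w_k]. *)

Set Implicit Arguments.
Unset Strict Implicit.
Unset Printing Implicit Defensive.

(** * Functions of class C^k on open sets *)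

(** Order is tested by words in fields whose coefficients are merely smooth, whereas the condition
    on [phi] speaks of its size near [0]. The two meet because a bound along each curve [t |-> t.x]
    separately is enough, with constants that depend on [x]: on such a curve the Taylor polynomial
    becomes a polynomial in the single variable [t], whose coefficient of degree [j] gathers all
    monomials of weight [j]. Low weights are thus excluded weight by weight, without a uniform
    estimate and without comparing individual coefficients. The remainder causes no trouble because
    all weights are positive: ordinary vanishing to order [m] implies weighted order at least [m].
    Of the frame, this argument sees only its components in the privileged chart, which are smooth
    functions [beta i l], and the orders of the coordinate functions. Since smoothness is defined by
    iterated partial derivatives in coordinate directions, differentiability, the chain rule and the
    symmetry of mixed derivatives are derived from there. *)

Section Calculus.
Variables (R : realType) (n : nat).
Local Notation V := 'rV[R]_n.
Local Notation e_ i := (delta_mx 0 i : V).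
Implicit Types (U : set V) (f g : V -> R) (x y v : V).

Lemma is_derive_line f y v (t : R) :
  derivable f (t *: v + y) v ->
  is_derive t 1 (fun s : R => f (s *: v + y)) ('D_v f (t *: v + y)).
Proof.
have E : (fun h : R => h^-1 *: (f ((h *: (1 : R) + t) *: v + y) - f (t *: v + y)))
  = (fun h : R => h^-1 *: (f (h *: v + (t *: v + y)) - f (t *: v + y))).
  by apply/funext => h; rewrite scalerDl -addrA [h *: 1]mulr1.
move=> df; apply: DeriveDef; first by rewrite /derivable /= E.
by rewrite /derive /= E.
Qed.

(** Bounding [t] by [|t| <= |c|] covers both signs of [c]; the segment actually used is [[0, c]] or
    [[c, 0]]. *)
Lemma line_MVT f y v (c : R) :
  (forall t, `|t| <= `|c| -> derivable f (t *: v + y) v) ->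
  exists2 t, `|t| <= `|c| & f (c *: v + y) - f y = c * 'D_v f (t *: v + y).
Proof.
move=> df; pose G (s : R) := f (s *: v + y).
have dG (t : R) : `|t| <= `|c| -> is_derive t 1 G ('D_v f (t *: v + y)).
  by move=> /df; exact: is_derive_line.
have cG (a b : R) : (forall t : R, t \in `[a, b]%R -> `|t| <= `|c|) ->
    {within `[a, b], continuous G}.
  by move=> h; apply: derivable_within_continuous => t /h /dG [].
have sub (a b : R) : (forall t : R, t \in `[a, b]%R -> `|t| <= `|c|) ->
    forall t : R, t \in `]a, b[%R -> is_derive t 1 G ('D_v f (t *: v + y)).
  by move=> h t /subset_itv_oo_cc /h /dG.
have G0 : G 0 = f y by rewrite /G scale0r add0r.
have [c0|c0] := leP 0 c.
  have H (t : R) : t \in `[0, c]%R -> `|t| <= `|c|.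
    by rewrite in_itv/= => /andP[t0 tc]; rewrite !ger0_norm.
  have [t tc E] := MVT_segment c0 (sub _ _ H) (cG _ _ H).
  by exists t; [exact: H|rewrite -/(G c) -G0 E subr0 mulrC].
have H (t : R) : t \in `[c, 0]%R -> `|t| <= `|c|.
  by rewrite in_itv/= => /andP[t0 tc]; rewrite !ler0_norm ?lerN2 ?(ltW c0).
have [t tc E] := MVT_segment (ltW c0) (sub _ _ H) (cG _ _ H).
exists t; first exact: H.
by rewrite -/(G c) -G0 -opprB E sub0r mulrN opprK mulrC.
Qed.

Lemma normr_row_le (h : V) (i : 'I_n) : `|h 0 i| <= `|h|.
Proof.
rewrite [leRHS]/Num.Def.normr /= mx_normrE.
exact: (le_bigmax _ (fun ij => `|h ij.1 ij.2|) (0, i)).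
Qed.

Lemma normr_row_ub (h : V) (c : R) :
  0 <= c -> (forall i, `|h 0 i| <= c) -> `|h| <= c.
Proof.
move=> c0 hc; rewrite [leLHS]/Num.Def.normr /= mx_normrE.
by apply: bigmax_le => // -[i j] _ /=; rewrite ord1.
Qed.

(** The vertices of the path from [0] to [h] that changes one coordinate at a time. *)
Definition row_prefix (k : nat) (h : V) : V :=
  \row_(i < n) (if (i < k)%N then h 0 i else 0).

Lemma norm_row_prefix k h : `|row_prefix k h| <= `|h|.
Proof.
apply: normr_row_ub => // i; rewrite mxE; case: ifP => _; last by rewrite normr0.
exact: normr_row_le.
Qed.

Lemma row_prefixS (i : 'I_n) h : row_prefix i.+1 h = h 0 i *: e_ i + row_prefix i h.
Proof.
apply/rowP => j; rewrite !mxE eqxx /= ltnS leq_eqVlt -val_eqE /=.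
by case: eqVneq => [/val_inj ->|_] /=; rewrite ?mulr1 ?ltnn ?addr0 ?mulr0 ?add0r.
Qed.

Lemma row_prefix0 h : row_prefix 0 h = 0.
Proof. by apply/rowP => j; rewrite !mxE. Qed.

Lemma row_prefixn h : row_prefix n h = h.
Proof. by apply/rowP => j; rewrite !mxE ltn_ord. Qed.

Lemma norm_delta_line (i : 'I_n) (t : R) : `|t *: e_ i| <= `|t|.
Proof.
apply: normr_row_ub => // j; rewrite !mxE eqxx/=.
by case: eqP => _; rewrite ?mulr1 ?mulr0 ?normr0.
Qed.

Definition grad f x (h : V) : R := \sum_(i < n) h 0 i * partial i f x.

Lemma grad_is_linear f x : linear (grad f x).
Proof.
move=> a u v; rewrite /grad scaler_sumr -big_split /=.
by apply: eq_bigr => i _; rewrite !mxE mulrDl scalerAl.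
Qed.

HB.instance Definition _ f x :=
  GRing.isLinear.Build R V R _ (grad f x) (grad_is_linear f x).

Lemma continuous_sum_at (T : topologicalType) (I : Type) (r : seq I)
    (F : I -> T -> R) (p : T) :
  (forall i, {for p, continuous (F i)}) ->
  {for p, continuous (fun q => \sum_(i <- r) F i q)}.
Proof.
move=> cF; elim: r => [|i r IH].
  rewrite (_ : (fun q => _) = cst 0); first exact: cvg_cst.
  by apply/funext => y; rewrite big_nil.
rewrite (_ : (fun q => _) = F i \+ (fun q => \sum_(i <- r) F i q)).
  by apply: continuousD; [exact: cF|exact: IH].
by apply/funext => y; rewrite big_cons.
Qed.

Lemma grad_continuous f x : continuous (grad f x).
Proof.
move=> h; apply: continuous_sum_at => i.
have C : {for h, continuous (fun M : V => M 0 i)} by exact: coord_continuous.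
apply: (@continuousM _ _ (fun M : V => M 0 i) (cst (partial i f x))) => //.
exact: cst_continuous.
Qed.

(* Moving from [x] to [x + h] one coordinate at a time, the mean value theorem
   compares each increment of [f] with the partial derivative at [x]. *)
Lemma C1_differentiable f x :
  (\forall y \near x, forall i, derivable f y (e_ i)) ->
  (forall i, {for x, continuous (partial i f)}) ->
  differentiable f x.
Proof.
move=> df cf.
suff E : f \o shift x = cst (f x) + grad f x +o_ (0 : V) id.
  have D := diff_unique (@grad_continuous f x) E.
  by apply/diff_locallyP; rewrite D; split => //; exact: grad_continuous.
apply/eqaddoP => e e0.
(* The share of [e] given to each coordinate; [n.+1] instead of [n] covers dimension [0] as well. *)
have e1 : 0 < e / n.+1%:R by rewrite divr_gt0.
have : \forall y \near x, forall i, derivable f y (e_ i) /\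
    `|partial i f x - partial i f y| <= e / n.+1%:R.
  pose P (i : 'I_n) (y : V) := derivable f y (e_ i) /\
    `|partial i f x - partial i f y| <= e / n.+1%:R.
  apply: (@filter_forall V _ P (nbhs x) (nbhs_filter x)) => i; apply: filterI.
    by apply: filterS df => y; exact.
  by move/cvgrPdist_le : (cf i); exact.
move=> /nbhs_ballP[d /= d0 hd].
have d2 : 0 < d / 2 by rewrite divr_gt0.
apply: filterS (@nbhs0_lt R V _ d2) => h h_lt.
have hd2 : `|h| + `|h| < d by move: h_lt; rewrite -[`|h| + _ < _]/(_ < _); lra.
have E : f (h + x) - f x =
    \sum_(i < n) (f (row_prefix i.+1 h + x) - f (row_prefix i h + x)).
  rewrite -(big_mkord xpredT (fun i => f (row_prefix i.+1 h + x) - f (row_prefix i h + x))).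
  by rewrite telescope_sumr // row_prefix0 row_prefixn add0r.
rewrite /= [X in `|X|](_ : _ = f (h + x) - f x - grad f x h); last first.
  by rewrite fctE /= /cst opprD addrA.
rewrite E /grad -sumrB (le_trans (ler_norm_sum _ _ _))//.
have : \sum_(i < n) `|f (row_prefix i.+1 h + x) - f (row_prefix i h + x)
    - h 0 i * partial i f x| <= \sum_(i < n) (`|h| * (e / n.+1%:R)).
  apply: ler_sum => i _.
  have near_line (t : R) : `|t| <= `|h 0 i| ->
      derivable f (t *: e_ i + (row_prefix i h + x)) (e_ i) /\
      `|partial i f x - partial i f (t *: e_ i + (row_prefix i h + x))| <= e / n.+1%:R.
    move=> th; apply: hd; rewrite -ball_normE /= addrA opprD addrCA subrr addr0 normrN.
    apply: le_lt_trans hd2; rewrite (le_trans (ler_normD _ _))// lerD//.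
      by rewrite (le_trans (norm_delta_line _ _))// (le_trans th)// normr_row_le.
    exact: norm_row_prefix.
  have [t th Et] := @line_MVT f (row_prefix i h + x) (e_ i) (h 0 i)
     (fun t th => (near_line t th).1).
  rewrite row_prefixS -[_ + row_prefix i h + x]addrA Et -mulrBr normrM.
  rewrite ler_pM// ?normr_row_le// distrC.
  exact: (near_line t th).2.
move=> /le_trans; apply.
rewrite sumr_const card_ord -[_ *+ n]mulr_natr [leRHS]mulrC -mulrA ler_wpM2l//.
rewrite -mulrA ler_piMr ?(ltW e0)// mulrC ler_pdivrMr// mul1r ler_nat.
exact: leqnSn.
Qed.

(** The recursion passes to all first derivatives at once, so that closure under sums, products and
    composition follows by induction on [k]; smoothness on [U] is [Ck k U] for every [k]. *)
Fixpoint Ck (k : nat) U f : Prop :=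
  (forall x, U x -> {for x, continuous f}) /\
  if k is k'.+1 then
    (forall x i, U x -> derivable f x (e_ i)) /\ forall i, Ck k' U (partial i f)
  else True.

Lemma Ck_continuous k U f x : Ck k U f -> U x -> {for x, continuous f}.
Proof. by case: k => [|k] [+ _] => /[apply]. Qed.

Lemma CkW k U f : Ck k.+1 U f -> Ck k U f.
Proof.
elim: k f => [|k IH] f [cf [df pf]]; first by [].
by split => //; split => // i; exact: IH.
Qed.

Lemma partial_near_eq x f g i :
  (\forall y \near x, f y = g y) -> partial i f x = partial i g x.
Proof. exact: near_eq_derive. Qed.

Lemma continuous_near_eq (T : topologicalType) (p : T) (u v : T -> R) :
  (\forall q \near p, u q = v q) -> {for p, continuous u} -> {for p, continuous v}.
Proof.
move=> uv cu; have uvp : u p = v p by exact: nbhs_singleton uv.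
rewrite /prop_for /continuous_at -uvp; apply: cvg_trans cu.
by apply: near_eq_cvg; apply: filterS uv => q ->.
Qed.

Lemma open_near_eq U f g x : open U -> (forall x, U x -> f x = g x) -> U x ->
  \forall y \near x, f y = g y.
Proof. by move=> oU fg Ux; apply: filterS (open_nbhs_nbhs (conj oU Ux)). Qed.

Lemma Ck_eq k U f g : open U -> (forall x, U x -> f x = g x) ->
  Ck k U f -> Ck k U g.
Proof.
move=> oU; elim: k f g => [|k IH] f g fg [cf df].
  by split => // x Ux; apply: continuous_near_eq (cf _ Ux); exact: open_near_eq fg Ux.
split.
  by move=> x Ux; apply: continuous_near_eq (cf _ Ux); exact: open_near_eq fg Ux.
case: df => df pf; split.
  move=> x i Ux; apply: near_eq_derivable (df x i Ux); exact: open_near_eq fg Ux.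
move=> i; apply: IH (pf i) => x Ux; apply: partial_near_eq; exact: open_near_eq fg Ux.
Qed.

Lemma Ck_differentiable k U f x : open U -> Ck k.+1 U f -> U x -> differentiable f x.
Proof.
move=> oU [cf [df pf]] Ux; apply: C1_differentiable.
  by apply: filterS (open_nbhs_nbhs (conj oU Ux)) => y Uy i; exact: df.
by move=> i; exact: Ck_continuous (pf i) Ux.
Qed.

Lemma partialD f g x i : derivable f x (e_ i) -> derivable g x (e_ i) ->
  partial i (fun y => f y + g y) x = partial i f x + partial i g x.
Proof. by move=> df dg; rewrite /partial -deriveD. Qed.

Lemma partialM f g x i : derivable f x (e_ i) -> derivable g x (e_ i) ->
  partial i (fun y => f y * g y) x = f x * partial i g x + partial i f x * g x.
Proof.
by move=> df dg; rewrite /partial (deriveM df dg) [_ * g x]mulrC.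
Qed.

Lemma partial_cst (c : R) i : partial i (fun _ : V => c) = fun=> 0.
Proof. by apply/funext => x; exact: (@derive_cst _ V R c x (e_ i)). Qed.

Lemma Ck_cst k U (c : R) : Ck k U (fun=> c).
Proof.
elim: k c => [|k IH] c; first by split => // x _; exact: cst_continuous.
split; first by move=> x _; exact: cst_continuous.
split; first by move=> x i _; exact: derivable_cst.
by move=> i; rewrite partial_cst.
Qed.

Lemma CkD k U f g : open U -> Ck k U f -> Ck k U g -> Ck k U (fun x => f x + g x).
Proof.
move=> oU; elim: k f g => [|k IH] f g [cf df] [cg dg].
  by split => // x Ux; apply: continuousD; [exact: cf|exact: cg].
split; first by move=> x Ux; apply: continuousD; [exact: cf|exact: cg].
case: df dg => df pf [dg pg]; split.
  by move=> x i Ux; apply: derivableD; [exact: df|exact: dg].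
move=> i; apply: Ck_eq (IH _ _ (pf i) (pg i)) => // x Ux.
by rewrite partialD//; [exact: df|exact: dg].
Qed.

Lemma CkM k U f g : open U -> Ck k U f -> Ck k U g -> Ck k U (fun x => f x * g x).
Proof.
move=> oU; elim: k f g => [|k IH] f g Cf Cg.
  case: Cf Cg => [cf _] [cg _].
  by split => // x Ux; apply: continuousM; [exact: cf|exact: cg].
(* In the Leibniz rule [f] and [g] also occur undifferentiated, where the induction hypothesis wants
   them one class lower. *)
have [Cf' Cg'] := (CkW Cf, CkW Cg).
case: Cf Cg => [cf [df pf]] [cg [dg pg]].
split; first by move=> x Ux; apply: continuousM; [exact: cf|exact: cg].
split.
  by move=> x i Ux; apply: derivableM; [exact: df|exact: dg].
move=> i; apply: (Ck_eq oU _ (CkD oU (IH _ _ Cf' (pg i)) (IH _ _ (pf i) Cg'))).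
by move=> x Ux; rewrite partialM//; [exact: df|exact: dg].
Qed.

Lemma Ck_sum k U (I : Type) (r : seq I) (F : I -> V -> R) : open U ->
  (forall i, Ck k U (F i)) -> Ck k U (fun x => \sum_(i <- r) F i x).
Proof.
move=> oU CF; elim: r => [|i r IH].
  by apply: Ck_eq (Ck_cst k U 0) => // x _; rewrite big_nil.
by apply: Ck_eq (CkD oU (CF i) IH) => // x _; rewrite big_cons.
Qed.

Lemma derivable_coord x (l : 'I_n) v : derivable (fun y : V => y 0 l) x v.
Proof. by apply: diff_derivable; exact: differentiable_coord. Qed.

Lemma partial_coord (l i : 'I_n) : partial i (fun y : V => y 0 l) = fun=> (l == i)%:R.
Proof.
apply/funext => x; rewrite /partial.
have := @derive_id R V x (e_ i).
rewrite derive_mx; last exact: derivable_id.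
by move=> /(congr1 (fun M : V => M 0 l)); rewrite !mxE eqxx.
Qed.

Lemma Ck_coord k U (l : 'I_n) : Ck k U (fun y => y 0 l).
Proof.
case: k => [|k]; first by split => // x _; exact: coord_continuous.
split; first by move=> x _; exact: coord_continuous.
split; first by move=> x i _; exact: derivable_coord.
by move=> i; rewrite partial_coord; exact: Ck_cst.
Qed.

(** The last letter is the derivative taken first. Inductions on words peel letters off at this end,
    which leaves a shorter word applied to another smooth function. *)
Lemma iter_partial_rcons s i f :
  iter_partial (rcons s i) f = iter_partial s (partial i f).
Proof. by rewrite /iter_partial foldr_rcons. Qed.

Lemma smooth_fun_on_partial U f i : smooth_fun_on U f -> smooth_fun_on U (partial i f).
Proof. by move=> sf x Ux s; rewrite -iter_partial_rcons; exact: sf. Qed.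

Lemma smooth_CkP U f : smooth_fun_on U f <-> forall k, Ck k U f.
Proof.
split=> [sf k|Cf x Ux s].
  elim: k f sf => [|k IH] f sf; first by split => // x Ux; exact: (sf x Ux [::]).1.
  split; first by move=> x Ux; exact: (sf x Ux [::]).1.
  split; first by move=> x i Ux; exact: (sf x Ux [::]).2.
  by move=> i; apply: IH; exact: smooth_fun_on_partial.
elim/last_ind: s f Cf => [|s i IH] f Cf.
  by split=> [|i]; [exact: (Cf 0%N).1|case: (Cf 1%N) => _ [+ _]; exact].
by rewrite iter_partial_rcons; apply: IH => k; case: (Cf k.+1) => _ [_]; exact.
Qed.

End Calculus.

(** * Chain rule and composition of maps of class C^k *)

Section Composition.
Variables (R : realType) (n m : nat).
Local Notation e_ i := (delta_mx 0 i : 'rV[R]_n).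
Implicit Types (F : 'rV[R]_n -> 'rV[R]_m) (g : 'rV[R]_m -> R).

Lemma continuous_row (T : topologicalType) (F : T -> 'rV[R]_m) (p : T) :
  (forall l, {for p, continuous (fun q => F q 0 l)}) -> {for p, continuous F}.
Proof.
move=> cF; apply/cvgrPdist_le => e e0.
pose P (l : 'I_m) (q : T) := `|F p 0 l - F q 0 l| <= e.
have := @filter_forall T _ P (nbhs p) (nbhs_filter p).
have PP l : \forall q \near p, P l q by move/cvgrPdist_le : (cF l); exact.
move=> /(_ PP); apply: filterS => q Pq.
by apply: normr_row_ub (ltW e0) _ => l; rewrite !mxE; exact: Pq.
Qed.

Lemma differentiable_row F (x : 'rV[R]_n) :
  (forall l, differentiable (fun y => F y 0 l) x) -> differentiable F x.
Proof.
move=> dF.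
have -> : F = \sum_(l < m) (fun y => F y 0 l *: (delta_mx 0 l : 'rV[R]_m)).
  by apply/funext => y; rewrite [LHS]row_sum_delta fct_sumE.
by apply: differentiable_sum => l; apply: differentiableZl; exact: dF.
Qed.

Lemma diff_partial g (y h : 'rV[R]_m) : differentiable g y ->
  'd g y h = \sum_(l < m) h 0 l * partial l g y.
Proof.
move=> dg; rewrite {1}[h]row_sum_delta linear_sum; apply: eq_bigr => l _.
by rewrite linearZ /partial deriveE.
Qed.

Lemma partial_comp F g (x : 'rV[R]_n) i :
  (forall l, differentiable (fun y => F y 0 l) x) -> differentiable g (F x) ->
  partial i (g \o F) x =
    \sum_(l < m) partial l g (F x) * partial i (fun y => F y 0 l) x.
Proof.
move=> dF dg; have dFx := differentiable_row dF.
rewrite /partial deriveE; last exact: differentiable_comp.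
rewrite diff_comp//= diff_partial//; apply: eq_bigr => l _.
rewrite mulrC; congr (_ * _).
rewrite -deriveE// derive_mx; last exact: diff_derivable.
by rewrite mxE.
Qed.

(** By the chain rule a partial derivative of [g \o F] is a sum of products of [partial l g \o F],
    covered by the induction hypothesis, and first derivatives of the components of [F]. *)
Lemma Ck_comp k (U : set 'rV[R]_n) (W : set 'rV[R]_m) F g :
  open U -> open W -> (forall x, U x -> W (F x)) ->
  (forall l, Ck k U (fun x => F x 0 l)) -> Ck k W g -> Ck k U (g \o F).
Proof.
move=> oU oW UW; elim: k g => [|k IH] g CF Cg.
  split => // x Ux; apply: continuous_comp; last first.
    by apply: Ck_continuous Cg _; exact: UW.
  by apply: continuous_row => l; exact: (Ck_continuous (CF l) Ux).
have CF' l : Ck k U (fun x => F x 0 l) by exact: CkW.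
have Cg' := CkW Cg.
have dF x l : U x -> differentiable (fun y => F y 0 l) x.
  by move=> Ux; exact: Ck_differentiable oU (CF l) Ux.
have dg x : W x -> differentiable g x by exact: Ck_differentiable oW Cg.
have dgF x : U x -> differentiable (g \o F) x.
  move=> Ux; apply: differentiable_comp; last exact/dg/UW.
  by apply: differentiable_row => l; exact: dF.
split; first by move=> x Ux; exact: differentiable_continuous (dgF x Ux).
split; first by move=> x i Ux; exact: diff_derivable (dgF x Ux).
move=> i; apply: (@Ck_eq _ _ _ _ (fun x =>
    \sum_(l < m) partial l g (F x) * partial i (fun y => F y 0 l) x)) => //.
  move=> x Ux; rewrite partial_comp// => [l|]; first exact: dF.
  exact/dg/UW.
apply: Ck_sum => // l; apply: CkM => //.
  by case: Cg => _ [_ pg]; exact: (IH (partial l g)) CF' (pg l).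
by case: (CF l) => _ [_]; exact.
Qed.

End Composition.

(** * Germs of smooth functions *)

Section SmoothNear.
Variables (R : realType).
Implicit Types n m : nat.

Lemma near_all (T : topologicalType) (x : T) (P : T -> Prop) :
  (forall y, P y) -> \forall y \near x, P y.
Proof. by move=> HP; apply: filterS (open_nbhs_nbhs (conj openT I)). Qed.

Lemma smooth_fun_onS n (U W : set 'rV[R]_n) (f : 'rV[R]_n -> R) :
  U `<=` W -> smooth_fun_on W f -> smooth_fun_on U f.
Proof. by move=> UW sf x /UW; exact: sf. Qed.

Lemma smooth_nearP n (x : 'rV[R]_n) (f : 'rV[R]_n -> R) :
  smooth_near x f <-> exists2 A, nbhs x A & smooth_fun_on A f.
Proof.
split=> [[U [oU Ux sf]]|[A xA sf]]; first by exists U => //; exact: open_nbhs_nbhs.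
exists A^°; split; [exact: open_interior|exact: xA|].
by apply: smooth_fun_onS sf; exact: interior_subset.
Qed.

Lemma smooth_near_near n (x : 'rV[R]_n) (f : 'rV[R]_n -> R) :
  smooth_near x f -> \forall y \near x, smooth_near y f.
Proof.
move=> [U [oU Ux sf]]; apply: filterS (open_nbhs_nbhs (conj oU Ux)) => y Uy.
by exists U.
Qed.

Lemma smooth_near_eq n (x : 'rV[R]_n) (f g : 'rV[R]_n -> R) :
  (\forall y \near x, f y = g y) -> smooth_near x f -> smooth_near x g.
Proof.
move=> fg [U [oU Ux sf]].
pose W := U `&` [set y | f y = g y]^°.
have oW : open W by apply: openI => //; exact: open_interior.
exists W; split => //; apply/smooth_CkP => k.
apply: (@Ck_eq _ _ _ _ f) => //; first by move=> y [_ /interior_subset].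
by apply/smooth_CkP: k; apply: smooth_fun_onS sf => y [].
Qed.

Lemma smooth_near_op2 n (x : 'rV[R]_n) (f g : 'rV[R]_n -> R) h :
  (forall k U, open U -> Ck k U f -> Ck k U g -> Ck k U h) ->
  smooth_near x f -> smooth_near x g -> smooth_near x h.
Proof.
move=> H [U [oU Ux sf]] [W [oW Wx sg]]; have oUW := openI oU oW.
exists (U `&` W); split => //; apply/smooth_CkP => k; apply: H => //.
  by apply/smooth_CkP: k; apply: smooth_fun_onS sf => y [].
by apply/smooth_CkP: k; apply: smooth_fun_onS sg => y [].
Qed.

Lemma smooth_nearD n (x : 'rV[R]_n) (f g : 'rV[R]_n -> R) :
  smooth_near x f -> smooth_near x g -> smooth_near x (fun y => f y + g y).
Proof. by apply: smooth_near_op2 => k U; exact: CkD. Qed.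

Lemma smooth_nearM n (x : 'rV[R]_n) (f g : 'rV[R]_n -> R) :
  smooth_near x f -> smooth_near x g -> smooth_near x (fun y => f y * g y).
Proof. by apply: smooth_near_op2 => k U; exact: CkM. Qed.

Lemma smooth_near_cst n (x : 'rV[R]_n) (c : R) : smooth_near x (fun=> c).
Proof.
exists setT; split => //; first exact: openT.
by apply/smooth_CkP => k; exact: Ck_cst.
Qed.

Lemma smooth_near_coord n (x : 'rV[R]_n) (l : 'I_n) :
  smooth_near x (fun y => y 0 l).
Proof.
exists setT; split => //; first exact: openT.
by apply/smooth_CkP => k; exact: Ck_coord.
Qed.

Lemma smooth_near_sum n (x : 'rV[R]_n) (I : Type) (r : seq I)
    (F : I -> 'rV[R]_n -> R) : (forall i, smooth_near x (F i)) ->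
  smooth_near x (fun y => \sum_(i <- r) F i y).
Proof.
move=> sF; elim: r => [|i r IH].
  apply: smooth_near_eq (smooth_near_cst x 0).
  by apply: near_all => y; rewrite big_nil.
apply: smooth_near_eq (smooth_nearD (sF i) IH).
by apply: near_all => y; rewrite big_cons.
Qed.

Lemma smooth_near_partial n (x : 'rV[R]_n) (f : 'rV[R]_n -> R) i :
  smooth_near x f -> smooth_near x (partial i f).
Proof.
move=> [U [oU Ux sf]]; exists U.
by split; [exact: oU|exact: Ux|exact: smooth_fun_on_partial].
Qed.

Lemma smooth_near_continuous n (x : 'rV[R]_n) (f : 'rV[R]_n -> R) :
  smooth_near x f -> {for x, continuous f}.
Proof. by move=> [U [_ Ux sf]]; exact: (sf x Ux [::]).1. Qed.

Lemma smooth_near_differentiable n (x : 'rV[R]_n) (f : 'rV[R]_n -> R) :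
  smooth_near x f -> differentiable f x.
Proof.
move=> [U [oU Ux sf]]; apply: (@Ck_differentiable _ _ 0 U) => //.
by move/smooth_CkP : sf; exact.
Qed.

Lemma smooth_near_derivable n (x : 'rV[R]_n) (f : 'rV[R]_n -> R) v :
  smooth_near x f -> derivable f x v.
Proof. by move=> /smooth_near_differentiable; exact: diff_derivable. Qed.

Lemma smooth_near_comp n m (x : 'rV[R]_n) (F : 'rV[R]_n -> 'rV[R]_m) g :
  (forall l, smooth_near x (fun y => F y 0 l)) -> smooth_near (F x) g ->
  smooth_near x (g \o F).
Proof.
move=> sF [W [oW WFx sg]].
have cF : {for x, continuous F}.
  by apply: continuous_row => l; exact: smooth_near_continuous.
have /choice[U hU] := sF.
pose A := [set y | W (F y)] `&` [set y | forall l, U l y].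
have xA : nbhs x A.
  apply: filterI; first by apply: cF; exact: open_nbhs_nbhs.
  apply: (@filter_forall _ _ U (nbhs x) (nbhs_filter x)) => l.
  by have [oU Ux _] := hU l; exact: open_nbhs_nbhs.
exists A^°; split; [exact: open_interior|exact: xA|].
apply/smooth_CkP => k; apply: (@Ck_comp _ _ _ _ _ W) => //.
- exact: open_interior.
- by move=> y /interior_subset[].
- move=> l; apply/smooth_CkP: k; have [_ _] := hU l.
  by apply: smooth_fun_onS => y /interior_subset[_].
- by apply/smooth_CkP: k.
Qed.

(** * Symmetry of mixed partial derivatives *)

Lemma partial_shift n (f : 'rV[R]_n -> R) (a z v : 'rV[R]_n) :
  derivable f (a + z) v ->
  is_derive z v (fun y => f (a + y)) ('D_v f (a + z)).
Proof.
have E : (fun h : R => h^-1 *: (f (a + (h *: v + z)) - f (a + z)))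
  = (fun h : R => h^-1 *: (f (h *: v + (a + z)) - f (a + z))).
  by apply/funext => h; rewrite addrCA.
move=> df; apply: DeriveDef; first by rewrite /derivable /= E.
by rewrite /derive /= E.
Qed.

Local Notation e_ i := (delta_mx 0 i : 'rV[R]_ _).

(** The mean value theorem is applied twice: along [e_i] to the increment [g] of [f] in the
    direction [e_j], then along [e_j] to [partial i f]. The left-hand side is unchanged when [i] and
    [j] are exchanged. *)
Lemma second_difference n (x : 'rV[R]_n) (f : 'rV[R]_n -> R) i j (h : R) :
  (forall y, `|x - y| <= `|h| + `|h| -> smooth_near y f) ->
  exists2 y, `|x - y| <= `|h| + `|h| &
    f (h *: e_ j + (h *: e_ i + x)) - f (h *: e_ i + x) - (f (h *: e_ j + x) - f x)
    = h * (h * partial j (partial i f) y).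
Proof.
move=> sf.
have near1 (s t : R) : `|s| <= `|h| -> `|t| <= `|h| ->
    `|x - (s *: e_ j + (t *: e_ i + x))| <= `|h| + `|h|.
  move=> sh th; rewrite addrA opprD addrCA subrr addr0 normrN.
  rewrite (le_trans (ler_normD _ _))// lerD//.
    exact: le_trans (norm_delta_line _ _) sh.
  exact: le_trans (norm_delta_line _ _) th.
have near0 (t : R) : `|t| <= `|h| -> `|x - (t *: e_ i + x)| <= `|h| + `|h|.
  move=> th; have := near1 0 t _ th; rewrite scale0r add0r; apply.
  by rewrite normr0.
pose g y := f (h *: e_ j + y) - f y.
have dg (t : R) : `|t| <= `|h| -> is_derive (t *: e_ i + x) (e_ i) g
    (partial i f (h *: e_ j + (t *: e_ i + x)) - partial i f (t *: e_ i + x)).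
  move=> th; apply: is_deriveB.
    by apply: partial_shift; apply: smooth_near_derivable; apply/sf/near1.
  by apply: derivableP; apply: smooth_near_derivable; apply/sf/near0.
have [t th Et] := @line_MVT _ _ g x (e_ i) h
  (fun t th => @ex_derive _ _ _ _ _ _ _ (dg t th)).
have dpf (s : R) : `|s| <= `|h| ->
    derivable (partial i f) (s *: e_ j + (t *: e_ i + x)) (e_ j).
  move=> sh; apply: smooth_near_derivable; apply: smooth_near_partial.
  by apply: sf; exact: near1.
have [s sh Es] := line_MVT dpf.
exists (s *: e_ j + (t *: e_ i + x)); first exact: near1.
rewrite -/(g (h *: e_ i + x)) -/(g x) Et; congr (h * _).
by have := @derive_val _ _ _ _ _ _ _ (dg t th) => ->.
Qed.

(* Both mixed derivatives are limits of the same second difference quotient. *)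
Lemma partialC n (x : 'rV[R]_n) (f : 'rV[R]_n -> R) i j : smooth_near x f ->
  partial i (partial j f) x = partial j (partial i f) x.
Proof.
have swap (p q r s : R) : p - q - (r - s) = p - r - (q - s) by lra.
have third (u v w : R) : 0 < u -> v < u / 3 -> w < u / 3 -> u <= v + w -> False.
  by lra.
have tri (u v w : R) : `|u - v| <= `|u - w| + `|v - w|.
  by rewrite [`|v - w|]distrC ler_distD.
move=> sf; apply/eqP; rewrite -subr_eq0 -normr_le0 leNgt; apply/negP => ab0.
set a := partial i (partial j f) x in ab0 *; set b := partial j (partial i f) x in ab0 *.
(* Near [x] both mixed derivatives stay within a third of the gap between [a] and [b]; a value
   common to the two, taken at nearby points [y] and [z], would make the gap less than two thirds of
   itself. *)
have e0 : 0 < `|a - b| / 3 by rewrite divr_gt0.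
have ca := smooth_near_continuous (smooth_near_partial i (smooth_near_partial j sf)).
have cb := smooth_near_continuous (smooth_near_partial j (smooth_near_partial i sf)).
move/cvgrPdist_lt : ca => /(_ _ e0) ha.
move/cvgrPdist_lt : cb => /(_ _ e0) hb.
pose P : set 'rV[R]_n := [set y | [/\ smooth_near y f,
    `|a - partial i (partial j f) y| < `|a - b| / 3 &
    `|b - partial j (partial i f) y| < `|a - b| / 3]].
have xP : nbhs x P.
  have sn := smooth_near_near sf.
  apply: filterS3 sn ha hb => y s1 s2 s3.
  by split; [exact: s1|exact: s2|exact: s3].
have [d d0 hd] : exists2 d : R, 0 < d & ball x d `<=` P by exact/nbhs_ballP.
(* The points in play lie within [2 * h] of [x], hence inside the ball of radius [d]. *)
pose h := d / 3; have h0 : 0 < h by rewrite divr_gt0.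
have hball y : `|x - y| <= `|h| + `|h| -> ball x d y.
  move=> xy; rewrite -ball_normE /=; apply: le_lt_trans xy _.
  by rewrite ger0_norm ?ltW// /h; lra.
have sfh y : `|x - y| <= `|h| + `|h| -> smooth_near y f by move=> /hball/hd[].
have [y yx Ey] := second_difference i j sfh.
have [z zx Ez] := second_difference j i sfh.
have [_ _ bz] := hd _ (hball _ yx).
have [_ az _] := hd _ (hball _ zx).
have yz : partial j (partial i f) y = partial i (partial j f) z.
  have h1 : h != 0 by rewrite gt_eqF.
  apply: (mulfI h1); apply: (mulfI h1).
  apply: (etrans (esym Ey)); apply: etrans Ez.
  have C := addrCA (h *: e_ j) (h *: e_ i) x.
  by rewrite C swap.
move: bz az; rewrite /= -/a -/b yz.
set c := partial _ _ z => bz az.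
apply: (third _ _ _ ab0 az bz).
exact: tri.
Qed.

End SmoothNear.

(** * Taylor polynomials *)

Section Taylor.
Variables (R : realType) (n : nat).
Local Notation V := 'rV[R]_n.
Local Notation e_ i := (delta_mx 0 i : V).
Implicit Types (f g p : V -> R) (x y : V) (i : 'I_n) (s : seq 'I_n).

Lemma partial_near f g x i : (\forall y \near x, f y = g y) ->
  \forall y \near x, partial i f y = partial i g y.
Proof.
move=> /nbhs_interior; apply: filterS => y fg.
by apply: partial_near_eq.
Qed.

Lemma partialZ (c : R) f x i : derivable f x (e_ i) ->
  partial i (fun y => c * f y) x = c * partial i f x.
Proof. by move=> df; exact: (deriveZ c df). Qed.

Lemma partial_sum x (I : Type) (r : seq I) (F : I -> V -> R) i :
  (forall k, smooth_near x (F k)) ->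
  partial i (fun y => \sum_(k <- r) F k y) x = \sum_(k <- r) partial i (F k) x.
Proof.
move=> sF; elim: r => [|k r IH].
  rewrite (_ : (fun y => _) = fun=> 0) ?partial_cst ?big_nil//.
  by apply/funext => y; rewrite big_nil.
rewrite (_ : (fun y => _) = fun y => F k y + \sum_(k <- r) F k y); last first.
  by apply/funext => y; rewrite big_cons.
rewrite partialD ?IH ?big_cons//; first exact: smooth_near_derivable.
by apply: smooth_near_derivable; exact: smooth_near_sum.
Qed.

(** Ordinary, unweighted vanishing to the finite order [m]. *)
Definition flat m f := forall s, (size s < m)%N -> iter_partial s f 0 = 0.

Lemma flatS m f : flat m.+1 f <-> (f 0 = 0 /\ forall i, flat m (partial i f)).
Proof.
split=> [H|[f0 H] s].
  split=> [|i s sm]; first exact: (H [::]).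
  by rewrite -iter_partial_rcons; apply: H; rewrite size_rcons.
case/lastP: s => [|s i]; first by [].
by rewrite size_rcons ltnS iter_partial_rcons => sm; exact: H.
Qed.

Lemma flatW m f : flat m.+1 f -> flat m f.
Proof. by move=> H s sm; apply: H; exact: ltnW. Qed.

Lemma flat_eq m f g : (\forall y \near (0 : V), f y = g y) -> flat m f -> flat m g.
Proof.
move=> fg H s sm; apply: etrans (H s sm); apply: esym.
elim/last_ind: s f g fg {H sm} => [|s i IH] f g fg; first exact: nbhs_singleton fg.
by rewrite !iter_partial_rcons; apply: IH; exact: partial_near.
Qed.

Lemma flatD m f g : smooth_near 0 f -> smooth_near 0 g ->
  flat m f -> flat m g -> flat m (fun x => f x + g x).
Proof.
elim: m f g => [|m IH] f g sf sg; first by [].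
move=> /flatS[f0 pf] /flatS[g0 pg]; apply/flatS; split; first by rewrite f0 g0 addr0.
move=> i; apply: flat_eq (IH _ _ _ _ (pf i) (pg i)); last 2 first.
- exact: smooth_near_partial.
- exact: smooth_near_partial.
apply: filterS2 (smooth_near_near sf) (smooth_near_near sg) => y sfy sgy.
by rewrite partialD//; exact: smooth_near_derivable.
Qed.

(** Induction by the Leibniz rule: [partial i g] is flat to one order less, as the induction
    requires, and in [partial i f * g] the factor [g] is flatter than required. *)
Lemma flatM m f g : smooth_near 0 f -> smooth_near 0 g ->
  flat m g -> flat m (fun x => f x * g x).
Proof.
elim: m f g => [|m IH] f g sf sg; first by [].
move=> fg; have fg' := flatW fg; move/flatS : fg => [g0 pg].
apply/flatS; split; first by rewrite g0 mulr0.
move=> i; have [spf spg] := (smooth_near_partial i sf, smooth_near_partial i sg).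
apply: flat_eq (flatD _ _ (IH _ _ sf spg (pg i)) (IH _ _ spf sg fg')); last 2 first.
- exact: smooth_nearM.
- exact: smooth_nearM.
apply: filterS2 (smooth_near_near sf) (smooth_near_near sg) => y sfy sgy.
by rewrite partialM//; exact: smooth_near_derivable.
Qed.

Lemma flat_sum m (I : Type) (r : seq I) (F : I -> V -> R) :
  (forall k, smooth_near 0 (F k)) -> (forall k, flat m (F k)) ->
  flat m (fun y => \sum_(k <- r) F k y).
Proof.
move=> sF H; elim: r => [|k r IH].
  have z : flat m (fun _ : V => 0 : R).
    elim: m {H} => [|m IH] //; apply/flatS; split => // i.
    by rewrite partial_cst.
  by apply: flat_eq z; apply: near_all => y; rewrite big_nil.
apply: flat_eq (flatD _ _ (H k) IH) => //.
  by apply: near_all => y; rewrite big_cons.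
exact: smooth_near_sum.
Qed.

(** The mean value theorem from [0] to [x] bounds [f x] by [|x|] times the partial derivatives at
    some [t *: x] with [|t| <= 1]; these are flat to one order less. *)
Lemma flat_bound m f : smooth_near 0 f -> flat m f ->
  exists C : R, 0 <= C /\ \forall x \near (0 : V), `|f x| <= C * `|x| ^+ m.
Proof.
elim: m f => [|m IH] f sf ff.
  exists (`|f 0| + 1); split; first by rewrite addr_ge0.
  have /cvgrPdist_lt/(_ _ ltr01) := smooth_near_continuous sf.
  apply: filterS => x /= fx; rewrite expr0 mulr1.
  rewrite -[f x](subKr (f 0)) (le_trans (ler_normB _ _))// lerD2l.
  exact: ltW.
move/flatS : ff => [f0 pf].
have /choice[C hC] := fun i => IH _ (smooth_near_partial i sf) (pf i).
exists (\sum_(i < n) C i); split; first by apply: sumr_ge0 => i _; have [] := hC i.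
have : \forall x \near (0 : V), smooth_near x f /\
    forall i, `|partial i f x| <= C i * `|x| ^+ m.
  apply: filterI; first exact: smooth_near_near.
  pose P i (x : V) := `|partial i f x| <= C i * `|x| ^+ m.
  apply: (@filter_forall V _ P (nbhs (0 : V)) (nbhs_filter (0 : V))) => i.
  by have [] := hC i.
move=> /nbhs_ballP[d /= d0 hd]; apply/nbhs_ballP; exists d => // x xd.
have hx (t : R) : `|t| <= `|1 : R| -> ball (0 : V) d (t *: x + 0).
  rewrite normr1 addr0 => t1; move: xd; rewrite -!ball_normE /= !sub0r !normrN.
  by apply: le_lt_trans; rewrite normrZ ler_piMl.
have [t t1 E] := @line_MVT _ _ f 0 x 1
   (fun t t1 => smooth_near_derivable (v := x) (hd _ (hx t t1)).1).
move: E; rewrite scale1r addr0 f0 subr0 mul1r => ->.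
have [sfx px] := hd _ (hx t t1).
rewrite deriveE; last exact: smooth_near_differentiable.
rewrite diff_partial; last exact: smooth_near_differentiable.
rewrite (le_trans (ler_norm_sum _ _ _))// mulr_suml; apply: ler_sum => i _.
rewrite normrM exprS mulrCA ler_pM// ?normr_row_le// (le_trans (px i))//.
rewrite ler_wpM2l//; first by have [] := hC i.
rewrite lerXn2r ?nnegrE// addr0 normrZ ler_piMl//.
by move: t1; rewrite normr1.
Qed.

(* [\sum_(i_1, ..., i_k) d_{i_1} ... d_{i_k} f(0) x_{i_1} ... x_{i_k}]; summing
   over words rather than multi-indices makes [1 / k`!] the Taylor coefficient. *)
Fixpoint word_sum k f x : R :=
  if k is k'.+1 then \sum_(i < n) x 0 i * word_sum k' (partial i f) x else f 0.

Definition taylor m f x : R := \sum_(k < m) (k`!%:R)^-1 * word_sum k f x.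

Lemma word_sum_eq k f g x : (\forall y \near (0 : V), f y = g y) ->
  word_sum k f x = word_sum k g x.
Proof.
elim: k f g => [|k IH] f g fg /=; first exact: nbhs_singleton fg.
by apply: eq_bigr => i _; congr (_ * _); apply: IH; exact: partial_near.
Qed.

Lemma smooth_word_sum k f x : smooth_near x (word_sum k f).
Proof.
elim: k f => [|k IH] f /=; first exact: smooth_near_cst.
by apply: smooth_near_sum => i; apply: smooth_nearM => //; exact: smooth_near_coord.
Qed.

Lemma smooth_taylor m f x : smooth_near x (taylor m f).
Proof.
apply: smooth_near_sum => k; apply: smooth_nearM; first exact: smooth_near_cst.
exact: smooth_word_sum.
Qed.

Lemma partial_word_sumS k f i x :
  partial i (word_sum k.+1 f) x = word_sum k (partial i f) x +
    \sum_(l < n) x 0 l * partial i (word_sum k (partial l f)) x.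
Proof.
rewrite /= partial_sum => [|l]; last first.
  by apply: smooth_nearM; [exact: smooth_near_coord|exact: smooth_word_sum].
rewrite (eq_bigr (fun l : 'I_n => x 0 l * partial i (word_sum k (partial l f)) x +
    (l == i)%:R * word_sum k (partial l f) x)); last first.
  move=> l _; rewrite partialM ?partial_coord//; first exact: derivable_coord.
  by apply: smooth_near_derivable; exact: smooth_word_sum.
rewrite big_split /= addrC; congr (_ + _).
rewrite (bigD1 i)//= eqxx mul1r big1 ?addr0// => l /negbTE ->.
by rewrite mul0r.
Qed.

(** The factor counts the positions of a letter [i] in a word of length [k.+1]. The first position
    gives one copy; induction gives [k] more once [partialC] has moved [partial i] past the
    derivative of the first letter. *)
Lemma partial_word_sum k f i x : smooth_near 0 f ->
  partial i (word_sum k.+1 f) x = k.+1%:R * word_sum k (partial i f) x.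
Proof.
elim: k f => [|k IH] f sf; rewrite partial_word_sumS.
  rewrite big1 ?addr0 ?mul1r// => l _.
  by rewrite (_ : word_sum 0 _ = fun=> partial l f 0)// partial_cst mulr0.
rewrite (eq_bigr (fun l : 'I_n => k.+1%:R *
    (x 0 l * word_sum k (partial l (partial i f)) x))); last first.
  move=> l _; rewrite IH; last exact: smooth_near_partial.
  have E : word_sum k (partial i (partial l f)) x =
      word_sum k (partial l (partial i f)) x.
    apply: word_sum_eq.
    by apply: filterS (smooth_near_near sf) => y; exact: partialC.
  apply: etrans (congr1 (fun u => k.+1%:R * (x 0 l * u)) E).
  exact: mulrCA.
rewrite -mulr_sumr -/(word_sum k.+1 (partial i f) x).
by rewrite -{1}[word_sum _ _ _]mul1r -mulrDl addrC natr1.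
Qed.

(** The derivative [partial i] takes [taylor m.+1 f] to [taylor m (partial i f)], as the factor
    [k.+1] lowers the factorial by one; so the claim for [f] reduces to the one for its
    derivatives. *)
Lemma taylor_flat m f : smooth_near 0 f -> flat m (fun x => f x - taylor m f x).
Proof.
elim: m f => [|m IH] f sf; first by [].
apply/flatS; split.
  rewrite /taylor big_ord_recl /= fact0 invr1 mul1r big1 ?addr0 ?subrr// => k _.
  by rewrite big1 ?mulr0// => i _; rewrite mxE mul0r.
move=> i; apply: flat_eq (IH _ (smooth_near_partial i sf)).
apply: filterS (smooth_near_near sf) => y sfy.
have -> : partial i (fun x => f x - taylor m.+1 f x) y =
    partial i f y - partial i (taylor m.+1 f) y.
  rewrite /partial (deriveB (smooth_near_derivable sfy))//.
  by apply: smooth_near_derivable; exact: smooth_taylor.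
congr (_ - _); rewrite /taylor partial_sum => [|k]; last first.
  apply: smooth_nearM; first exact: smooth_near_cst.
  exact: smooth_word_sum.
have pZ k : partial i (fun z => (k`!%:R)^-1 * word_sum k f z) y =
    (k`!%:R)^-1 * partial i (word_sum k f) y.
  by apply: partialZ; apply: smooth_near_derivable; exact: smooth_word_sum.
rewrite big_ord_recl pZ (_ : word_sum 0 f = fun=> f 0)// partial_cst mulr0 add0r.
apply: eq_bigr => k _; rewrite pZ partial_word_sum// lift0 factS natrM invfM.
by rewrite mulrCA !mulrA divff ?mul1r ?pnatr_eq0// -mulrA mulrC.
Qed.

End Taylor.

(** * Order with respect to a frame in coordinates *)

Section WeightedOrder.
Variables (R : realType) (n : nat) (w : 'I_n -> nat).
Hypothesis w_gt0 : forall i, (0 < w i)%N.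
Variable beta : 'I_n -> 'I_n -> 'rV[R]_n -> R.
Hypothesis smooth_beta : forall i l, smooth_near 0 (beta i l).
Local Notation V := 'rV[R]_n.
Implicit Types (f g : V -> R) (x : V) (i : 'I_n) (J : seq 'I_n).

(** Later [beta i l] is the component of [X i] along the [l]-th coordinate of a privileged chart. *)
Definition coef_field i f x : R := \sum_(l < n) beta i l x * partial l f x.

Definition coef_word J f : V -> R := foldr coef_field f J.

Definition weight_of J : nat := (\sum_(i <- J) w i)%N.

(** The counterpart of [order_ge] in coordinates centered at the point. *)
Definition frame_order m f := forall J, (weight_of J < m)%N -> coef_word J f 0 = 0.

Lemma coef_word_rcons J i f : coef_word (rcons J i) f = coef_word J (coef_field i f).
Proof. by rewrite /coef_word foldr_rcons. Qed.

Lemma weight_of_rcons J i : weight_of (rcons J i) = (weight_of J + w i)%N.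
Proof. by rewrite /weight_of -cats1 big_cat big_seq1. Qed.

Lemma smooth_coef_field i f : smooth_near 0 f -> smooth_near 0 (coef_field i f).
Proof.
move=> sf; apply: smooth_near_sum => l; apply: smooth_nearM; first exact: smooth_beta.
exact: smooth_near_partial.
Qed.

Lemma coef_field_near i f g : (\forall y \near (0 : V), f y = g y) ->
  \forall y \near (0 : V), coef_field i f y = coef_field i g y.
Proof.
move=> /nbhs_interior; apply: filterS => y fg.
by apply: eq_bigr => l _; rewrite (partial_near_eq _ fg).
Qed.

Lemma coef_word_near J f g : (\forall y \near (0 : V), f y = g y) ->
  \forall y \near (0 : V), coef_word J f y = coef_word J g y.
Proof. by move=> fg; elim: J => [|i J IH] //=; exact: coef_field_near. Qed.

Lemma smooth_coef_word J f : smooth_near 0 f -> smooth_near 0 (coef_word J f).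
Proof. by move=> sf; elim: J => [|i J IH] //=; exact: smooth_coef_field. Qed.

Lemma coef_fieldD i f g x : smooth_near x f -> smooth_near x g ->
  coef_field i (fun y => f y + g y) x = coef_field i f x + coef_field i g x.
Proof.
move=> sf sg; rewrite /coef_field -big_split; apply: eq_bigr => l _ /=.
by rewrite partialD ?mulrDr//; exact: smooth_near_derivable.
Qed.

Lemma coef_fieldM i f g x : smooth_near x f -> smooth_near x g ->
  coef_field i (fun y => f y * g y) x = f x * coef_field i g x + coef_field i f x * g x.
Proof.
move=> sf sg; rewrite /coef_field mulr_sumr mulr_suml -big_split; apply: eq_bigr => l _ /=.
rewrite partialM; [|exact: smooth_near_derivable..].
by rewrite mulrDr mulrCA !mulrA.
Qed.

Lemma coef_wordD J f g : smooth_near 0 f -> smooth_near 0 g ->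
  coef_word J (fun y => f y + g y) 0 = coef_word J f 0 + coef_word J g 0.
Proof.
elim/last_ind: J f g => [|J i IH] f g sf sg //.
rewrite !coef_word_rcons -IH; [|exact: smooth_coef_field..].
have E : \forall y \near (0 : V), coef_field i (fun z => f z + g z) y =
    coef_field i f y + coef_field i g y.
  apply: filterS2 (smooth_near_near sf) (smooth_near_near sg) => y.
  exact: coef_fieldD.
exact: nbhs_singleton (coef_word_near J E).
Qed.

Lemma coef_word_cst J (c : R) : (0 < size J)%N -> coef_word J (fun=> c) 0 = 0.
Proof.
case/lastP: J => // J i _; rewrite coef_word_rcons.
have -> : coef_field i (fun=> c) = fun=> 0.
  by apply/funext => x; rewrite /coef_field big1// => l _; rewrite partial_cst mulr0.
elim/last_ind: J => [|J j IH] //; rewrite coef_word_rcons.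
suff -> : coef_field j (fun=> 0) = fun=> 0 by [].
by apply/funext => x; rewrite /coef_field big1// => l _; rewrite partial_cst mulr0.
Qed.

Lemma frame_order_eq m f g : (\forall y \near (0 : V), f y = g y) ->
  frame_order m f -> frame_order m g.
Proof.
move=> fg H J Jm; apply: etrans (H J Jm); apply: esym.
exact: nbhs_singleton (coef_word_near J fg).
Qed.

Lemma frame_orderD m f g : smooth_near 0 f -> smooth_near 0 g ->
  frame_order m f -> frame_order m g -> frame_order m (fun y => f y + g y).
Proof. by move=> sf sg Hf Hg J Jm; rewrite coef_wordD// Hf// Hg// addr0. Qed.

(** Subtraction is truncated: for [m <= w i] the conclusion concerns order [0], which is no
    condition. *)
Lemma frame_order_coef_field m f i : frame_order m f -> frame_order (m - w i) (coef_field i f).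
Proof.
move=> H J Jm; rewrite -coef_word_rcons; apply: H; rewrite weight_of_rcons; lia.
Qed.

(** The field applied first falls on one of the factors and costs it at most [w i]. Truncated
    subtraction only helps, since [a + (b - w i)] is never below [a + b - w i]. *)
Lemma frame_orderM a b f g : smooth_near 0 f -> smooth_near 0 g ->
  frame_order a f -> frame_order b g -> frame_order (a + b) (fun y => f y * g y).
Proof.
move=> sf sg Hf Hg J; elim/last_ind: J a b f g sf sg Hf Hg
  => [|J i IH] a b f g sf sg Hf Hg.
  rewrite /weight_of big_nil addn_gt0 => /orP[a0|b0] /=.
    by rewrite [f 0](Hf [::]) ?mul0r// /weight_of big_nil.
  by rewrite [g 0](Hg [::]) ?mulr0// /weight_of big_nil.
rewrite weight_of_rcons coef_word_rcons => Jab.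
have E : \forall y \near (0 : V), coef_field i (fun z => f z * g z) y =
    f y * coef_field i g y + coef_field i f y * g y.
  apply: filterS2 (smooth_near_near sf) (smooth_near_near sg) => y.
  exact: coef_fieldM.
have [sf' sg'] := (smooth_coef_field i sf, smooth_coef_field i sg).
have J1 : (weight_of J < a + (b - w i))%N by lia.
have J2 : (weight_of J < a - w i + b)%N by lia.
have E1 := IH _ _ _ _ sf sg' Hf (frame_order_coef_field Hg) J1.
have E2 := IH _ _ _ _ sf' sg (frame_order_coef_field Hf) Hg J2.
rewrite (nbhs_singleton (coef_word_near J E)).
by rewrite (coef_wordD J (smooth_nearM sf sg') (smooth_nearM sf' sg)) E1 E2 addr0.
Qed.

Lemma frame_order_cst (c : R) : frame_order 0 (fun=> c).
Proof. by []. Qed.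

Lemma frame_order_zero m : frame_order m (fun=> 0).
Proof. by case=> [|i J] _ //; exact: coef_word_cst. Qed.

Lemma frame_order_sum m (I : Type) (r : seq I) (F : I -> V -> R) :
  (forall k, smooth_near 0 (F k)) -> (forall k, frame_order m (F k)) ->
  frame_order m (fun y => \sum_(k <- r) F k y).
Proof.
move=> sF H; elim: r => [|k r IH].
  apply: frame_order_eq (@frame_order_zero m).
  by apply: near_all => y; rewrite big_nil.
apply: frame_order_eq (frame_orderD _ _ (H k) IH) => //; last exact: smooth_near_sum.
by apply: near_all => y; rewrite big_cons.
Qed.

Lemma flat_coef_field m f i : smooth_near 0 f -> flat m.+1 f -> flat m (coef_field i f).
Proof.
move=> sf /flatS[_ pf]; apply: flat_sum => l.
  apply: smooth_nearM; first exact: smooth_beta.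
  exact: smooth_near_partial.
exact: flatM (smooth_beta i l) (smooth_near_partial l sf) (pf l).
Qed.

Lemma size_le_weight J : (size J <= weight_of J)%N.
Proof.
rewrite /weight_of; elim: J => [|i J IH] //=; rewrite big_cons.
by have := w_gt0 i; lia.
Qed.

(** Weights are at least [1], so a word of weight less than [m] differentiates fewer than [m]
    times. *)
Lemma flat_frame_order m f : smooth_near 0 f -> flat m f -> frame_order m f.
Proof.
move=> sf ff J /(leq_ltn_trans (size_le_weight J)).
elim/last_ind: J m f sf ff => [|J i IH] m f sf ff sm; first exact: (ff [::]).
rewrite coef_word_rcons; case: m ff sm => // m ff; rewrite size_rcons ltnS => sm.
exact: (IH m _ (smooth_coef_field i sf) (flat_coef_field i sf ff) sm).
Qed.

(** Words match the terms of [word_sum]. One monomial is given by several words, which is harmless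
    because its coefficients are never compared. *)
Definition word_monomial J x : R := \prod_(i <- J) x 0 i.

Lemma smooth_word_monomial J x : smooth_near x (word_monomial J).
Proof.
elim: J => [|i J IH].
  apply: smooth_near_eq (smooth_near_cst x 1).
  by apply: near_all => y; rewrite /word_monomial big_nil.
apply: smooth_near_eq (smooth_nearM (smooth_near_coord x i) IH).
by apply: near_all => y; rewrite /word_monomial big_cons.
Qed.

Lemma word_monomial_dilation J (t : R) x :
  word_monomial J (dilation w t x) = t ^+ weight_of J * word_monomial J x.
Proof.
rewrite /word_monomial /weight_of; elim: J => [|i J IH].
  by rewrite !big_nil mulr1.
by rewrite !big_cons IH mxE exprD; ring.
Qed.

Hypothesis coord_order : forall k, frame_order (w k) (fun x => x 0 k).

Lemma word_monomial_order J : frame_order (weight_of J) (word_monomial J).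
Proof.
elim: J => [|i J IH]; first by rewrite /weight_of big_nil.
rewrite /weight_of big_cons.
apply: frame_order_eq (frame_orderM _ _ (coord_order (k := i)) IH).
- by apply: near_all => y; rewrite /word_monomial big_cons.
- exact: smooth_near_coord.
- exact: smooth_word_monomial.
Qed.

Lemma frame_orderZ m (c : R) f : smooth_near 0 f -> frame_order m f ->
  frame_order m (fun y => c * f y).
Proof.
move=> sf Hf; have := frame_orderM (smooth_near_cst 0 c) sf (frame_order_cst c) Hf.
by [].
Qed.

Lemma frame_orderW m m' f : (m <= m')%N -> frame_order m' f -> frame_order m f.
Proof. by move=> mm' H J Jm; apply: H; exact: leq_trans mm'. Qed.

Definition word_poly (L : seq (R * seq 'I_n)) x : R :=
  \sum_(c <- L) c.1 * word_monomial c.2 x.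

Lemma word_sum_poly k f : exists L, word_sum k f =1 word_poly L.
Proof.
elim: k f => [|k IH] f.
  exists [:: (f 0, [::])] => x.
  by rewrite /word_poly big_seq1 /= /word_monomial big_nil mulr1.
have /choice[L hL] := fun i => IH (partial i f).
exists (flatten [seq [seq (c.1, i :: c.2) | c <- L i] | i <- enum 'I_n]) => x.
rewrite /word_poly big_flatten /= big_map big_enum /=; apply: eq_bigr => i _.
rewrite hL big_map mulr_sumr; apply: eq_bigr => c _ /=.
by rewrite /word_monomial big_cons mulrCA.
Qed.

Lemma taylor_poly m f : exists L, taylor m f =1 word_poly L.
Proof.
have /choice[L hL] := fun k => word_sum_poly k f.
exists (flatten [seq [seq ((k`!%:R)^-1 * c.1, c.2) | c <- L k] |
  k <- map val (enum 'I_m)]) => x.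
rewrite /word_poly big_flatten /= big_map big_map big_enum /=; apply: eq_bigr => k _.
rewrite hL big_map mulr_sumr; apply: eq_bigr => c _ /=.
by rewrite mulrA.
Qed.

End WeightedOrder.

(** * From bounds along dilation orbits to weighted order *)

(** The constant term is the limit of [p.[t]] as [t] decreases to [0], hence zero; dividing by ['X]
    lowers [m] by one in the bound. *)
Lemma poly_small_coef (R : realType) (m : nat) (p : {poly R}) (C d : R) :
  0 < d -> (forall t, 0 < t -> t < d -> `|p.[t]| <= C * t ^+ m) ->
  forall j, (j < m)%N -> p`_j = 0.
Proof.
elim: m p => [|m IH] p d0 H j; first by [].
have [q [c Epq]] : exists q c, p = q * 'X + c%:P.
  by elim/poly_ind: p {H} => [|q c _]; [exists 0, 0; rewrite mul0r add0r polyC0|exists q, c].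
have c0 : c = 0.
  pose B := \sum_(i < size q) `|q`_i|.
  have B0 : 0 <= B by apply: sumr_ge0.
  have qB t : 0 < t -> t < 1 -> `|q.[t]| <= B.
    move=> t0 t1; rewrite horner_coef (le_trans (ler_norm_sum _ _ _))//.
    apply: ler_sum => i _; rewrite normrM ler_piMr// [`|t ^+ i|]ger0_norm ?exprn_ge0 ?(ltW t0)//.
    by rewrite exprn_ile1 ?ltW.
  apply/eqP; rewrite -normr_le0 leNgt; apply/negP => cp.
  (* A nonzero [c] would satisfy [|c| <= |C| * t + B * t <= t * K] for small [t], while the last
     entry of the minimum defining [t] makes [t * K] at most [|c| / 2]. The summand [1] keeps [K]
     positive. *)
  pose K := `|C| + B + 1.
  have K0 : 0 < K by rewrite /K -addrA ltr_wpDl// ltr_wpDl.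
  pose t := Num.min (Num.min (d / 2) (1 / 2)) (`|c| / (2 * K)).
  have t0 : 0 < t by rewrite /t !lt_min !divr_gt0//= mulr_gt0.
  have td : t < d.
    apply: (@le_lt_trans _ _ (d / 2)); first by rewrite /t !ge_min lexx.
    by rewrite ltr_pdivrMr// ltr_pMr// ltr1n.
  have t1 : t < 1.
    apply: (@le_lt_trans _ _ (1 / 2)); first by rewrite /t !ge_min lexx orbT.
    by rewrite ltr_pdivrMr// mul1r ltr1n.
  have tK : t * K <= `|c| / 2.
    apply: (@le_trans _ _ (`|c| / (2 * K) * K)).
      by rewrite ler_wpM2r ?(ltW K0)// /t !ge_min lexx orbT.
    by rewrite invfM mulrA -mulrA mulVf ?gt_eqF// mulr1.
  have Hp : `|p.[t]| <= `|C| * t.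
    apply: (le_trans (H t t0 td)); apply: (@le_trans _ _ (`|C| * t ^+ m.+1)).
      by rewrite ler_wpM2r ?exprn_ge0 ?(ltW t0)// ler_norm.
    rewrite ler_wpM2l// exprS ler_piMr ?(ltW t0)//.
    by rewrite exprn_ile1 ?ltW.
  have Ec : c = p.[t] - q.[t] * t by rewrite Epq hornerMXaddC addrC addKr.
  have : `|c| <= `|C| * t + B * t.
    rewrite {1}Ec (le_trans (ler_normB _ _))// lerD//.
    by rewrite normrM (gtr0_norm t0) ler_wpM2r ?(ltW t0)// qB.
  have : `|C| * t + B * t <= t * K.
    by rewrite -mulrDl mulrC ler_wpM2l ?(ltW t0)// /K lerDl.
  move=> h1 h2; have := le_trans h2 (le_trans h1 tK).
  by rewrite ler_pdivlMr// leNgt ltr_pMr// ltr1n.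
have Hq t : 0 < t -> t < d -> `|q.[t]| <= C * t ^+ m.
  move=> t0 td; have := H t t0 td; rewrite Epq c0 addr0 hornerMX normrM (gtr0_norm t0).
  by rewrite exprSr mulrA ler_pM2r.
case: j => [|j] jm; rewrite Epq c0 addr0 coefMX//=.
exact: IH Hq _ _.
Qed.

Section RadialBound.
Variables (R : realType) (n : nat) (w : 'I_n -> nat).
Hypothesis w_gt0 : forall i, (0 < w i)%N.
Local Notation V := 'rV[R]_n.

Lemma norm_dilation_le (t : R) (x : V) : 0 < t -> t < 1 ->
  `|dilation w t x| <= t * `|x|.
Proof.
move=> t0 t1; apply: normr_row_ub; first by rewrite mulr_ge0// ltW.
move=> i; rewrite mxE normrM ler_pM// ?normr_row_le//.
rewrite ger0_norm ?exprn_ge0 ?(ltW t0)//.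
have := w_gt0 i; case: (w i) => // j _; rewrite exprS ler_piMr ?(ltW t0)//.
by rewrite exprn_ile1 ?ltW.
Qed.

Lemma dilation_near0 (A : set V) (x : V) : nbhs (0 : V) A ->
  exists2 d : R, 0 < d & forall t, 0 < t -> t < d -> t < 1 /\ A (dilation w t x).
Proof.
move=> /nbhs_ballP[e e0 eA]; have {}e0 : 0 < e by [].
have x1 : 0 < `|x| + 1 by rewrite ltr_wpDl.
exists (Num.min 1 (e / (`|x| + 1))) => [|t t0].
  by rewrite lt_min ltr01 divr_gt0.
rewrite lt_min => /andP[t1 te]; split => //; apply: eA.
rewrite -ball_normE /ball_ /= sub0r normrN.
apply: le_lt_trans (norm_dilation_le x t0 t1) _.
apply: (@le_lt_trans _ _ (t * (`|x| + 1))); first by rewrite ler_wpM2l ?(ltW t0)// lerDl.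
by rewrite -ltr_pdivlMr.
Qed.

Variable beta : 'I_n -> 'I_n -> V -> R.
Hypothesis smooth_beta : forall i l, smooth_near 0 (beta i l).
Hypothesis coord_order : forall k, frame_order w beta (w k) (fun x => x 0 k).

(* The Taylor polynomial of [g] inherits the radial bound, hence its part of
   weight less than [m] vanishes; the other monomials have order at least [m],
   and the Taylor remainder is flat. *)
Lemma radial_bound_frame_order m (g : V -> R) : smooth_near 0 g ->
  (forall x, exists C d : R, 0 < d /\
     forall t, 0 < t -> t < d -> `|g (dilation w t x)| <= C * t ^+ m) ->
  frame_order w beta m g.
Proof.
move=> sg Hg; pose r x := g x - taylor m g x.
have sr : smooth_near 0 r.
  have := smooth_nearD sg (smooth_nearM (smooth_near_cst 0 (-1)) (smooth_taylor m g 0)).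
  by apply: smooth_near_eq; apply: near_all => y; rewrite mulN1r.
have fr : flat m r := @taylor_flat R n m g sg.
have [K [K0 rK]] := flat_bound sr fr.
have [L TL] := taylor_poly m g.
(* Terms of weight less than [m] are replaced by [0]; [TF] shows that the sum does not change. *)
pose F (c : R * seq 'I_n) : V -> R :=
  if (m <= weight_of w c.2)%N then fun x => c.1 * word_monomial c.2 x else fun=> 0.
have TF x : taylor m g x = \sum_(c <- L) F c x.
  (* For fixed [x], the Taylor polynomial at [t.x] as a polynomial in [t]. *)
  pose p : {poly R} :=
    \sum_(c <- L) (c.1 * word_monomial c.2 x) *: 'X^(weight_of w c.2).
  have pE t : p.[t] = taylor m g (dilation w t x).
    rewrite TL /word_poly /p horner_sum; apply: eq_bigr => c _.
    by rewrite hornerZ hornerXn word_monomial_dilation mulrAC -mulrA.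
  have [C [d1 [d10 HC]]] := Hg x.
  have [d2 d20 Hd] := dilation_near0 x rK.
  (* [C] comes from [g], and [K * |x| ^+ m] from the remainder, since the norm of [t.x] is at most
     [t * |x|]. *)
  have p0 := @poly_small_coef R m p (C + K * `|x| ^+ m) (Num.min d1 d2).
  have {}p0 j : (j < m)%N -> p`_j = 0.
    apply: p0; first by rewrite lt_min d10.
    move=> t t0; rewrite lt_min => /andP[td1 td2]; have [t1 Hr] := Hd t t0 td2.
    rewrite pE -[taylor _ _ _](subKr (g (dilation w t x))).
    rewrite (le_trans (ler_normB _ _))// mulrDl lerD//; first exact: HC.
    apply: le_trans Hr _; rewrite -mulrA ler_wpM2l// mulrC -exprMn.
    by rewrite lerXn2r ?nnegrE ?mulr_ge0 ?(ltW t0)// norm_dilation_le.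
  rewrite TL /word_poly (bigID (fun c => (m <= weight_of w c.2)%N)) /=.
  (* Grouped by weight, the terms of weight less than [m] are exactly the coefficients of [p] of
     degree less than [m]. *)
  rewrite [X in _ + X](_ : _ = \sum_(j < m) p`_j); last first.
    rewrite /p (eq_bigr (fun j : 'I_m => \sum_(c <- L)
       (c.1 * word_monomial c.2 x) * (val j == weight_of w c.2)%:R)); last first.
      by move=> j _; rewrite coef_sum; apply: eq_bigr => c _; rewrite coefZ coefXn.
    rewrite exchange_big /= big_mkcond /=; apply: eq_bigr => c _.
    rewrite -ltnNge -mulr_sumr; case: ltnP => cm.
      rewrite (bigD1 (Ordinal cm))//= eqxx big1 ?addr0 ?mulr1// => j.
      by rewrite -val_eqE /= => /negbTE ->.
    rewrite big1 ?mulr0// => j _; case: eqP => // E.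
    by move: cm; rewrite -E leqNgt ltn_ord.
  rewrite [X in _ + X]big1 ?addr0 => [|j _]; last exact: p0.
  by rewrite big_mkcond /=; apply: eq_bigr => c _; rewrite /F; case: ifP.
have HF : frame_order w beta m (fun x => \sum_(c <- L) F c x).
  apply: frame_order_sum => // c; rewrite /F; case: ifP => cm.
  - by apply: smooth_nearM; [exact: smooth_near_cst|exact: smooth_word_monomial].
  - exact: smooth_near_cst.
  - apply: (frame_orderZ smooth_beta); first exact: smooth_word_monomial.
    by apply: frame_orderW cm _; exact: word_monomial_order.
  - exact: frame_order_zero.
have Hr := flat_frame_order w_gt0 smooth_beta sr fr.
apply: frame_order_eq (frame_orderD smooth_beta _ sr HF Hr); last first.
  apply: smooth_near_eq (smooth_taylor m g 0).
  by apply: near_all => y; rewrite TF.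
by apply: near_all => y; rewrite -TF /r addrC subrK.
Qed.

End RadialBound.

(** * Fields and charts *)

Section Charts.
Variables (R : realType) (n : nat) (M : manifold R n).
Implicit Types (c d : chart R n M) (p q : M) (f g : M -> R).
Local Notation V := 'rV[R]_n.

Definition local_expr c f : V -> R := fun x => f (cinv c x).

Definition chart_coord c (k : 'I_n) : M -> R := fun q => c q 0 k.

Lemma chartK c p : cdom c p -> cinv c (c p) = p.
Proof. by case: c => /= ? ? ? _ _ + _ _; exact. Qed.

Lemma chart_dom_near c p : cdom c p -> \forall q \near p, cdom c q.
Proof. by move=> cp; case: c cp => /= D ? ? oD _ _ _ _ Dp; exact: open_nbhs_nbhs. Qed.

Lemma chart_continuous c p : cdom c p -> {for p, continuous c}.
Proof. by case: c => /= ? ? ? _ _ _ + _; exact. Qed.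

Lemma cinv_continuous c p : cdom c p -> {for c p, continuous (cinv c)}.
Proof. by case: c => /= ? ? ? _ _ _ _; exact. Qed.

Lemma chart_image_near c p : cdom c p ->
  \forall x \near c p, cdom c (cinv c x) /\ c (cinv c x) = x.
Proof.
move=> cp; have oi : open (c @` cdom c) by case: c {cp} => /= ? ? ? _ + _ _ _.
have : nbhs (c p) (c @` cdom c) by apply: open_nbhs_nbhs; split => //; exists p.
by apply: filterS => _ [q cq <-]; rewrite chartK.
Qed.

Lemma near_chart c p (P : M -> Prop) : cdom c p ->
  (\forall q \near p, P q) -> \forall x \near c p, P (cinv c x).
Proof. by move=> cp pP; apply: (cinv_continuous cp); rewrite /= chartK. Qed.

Lemma near_chartI c p (P : V -> Prop) : cdom c p ->
  (\forall x \near c p, P x) -> \forall q \near p, P (c q).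
Proof. by move=> cp pP; exact: (chart_continuous cp pP). Qed.

Lemma atlas_compatible c d : atlas c -> atlas d -> chart_compatible c d.
Proof. by case: M c d => /= ? ? ? ? ? comp ? c d; exact: comp. Qed.

Lemma transition_smooth c d p (k : 'I_n) : atlas c -> atlas d ->
  cdom c p -> cdom d p -> smooth_near (d p) (fun x => c (cinv d x) 0 k).
Proof.
move=> Ac Ad cp dp; have [_ sm] := atlas_compatible Ac Ad.
apply/smooth_nearP; exists (d @` (cdom c `&` cdom d)); last exact: (sm k).
apply: filterS2 (chart_image_near dp) (near_chart dp (chart_dom_near cp)).
by move=> x [dx xE] cx; exists (cinv d x).
Qed.

Lemma local_expr_transition c d p f : cdom c p -> cdom d p ->
  \forall x \near d p,
    local_expr d f x = (local_expr c f \o (fun y => c (cinv d y))) x.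
Proof.
move=> cp dp; apply: filterS (near_chart dp (chart_dom_near cp)) => x cx.
by rewrite /local_expr /= chartK.
Qed.

(** [smooth_at] supplies some chart of the atlas; the smooth transition map leads from it to the
    given one. *)
Lemma smooth_at_chart c p f : atlas c -> cdom c p -> smooth_at p f ->
  smooth_near (c p) (local_expr c f).
Proof.
move=> Ac cp [d [Ad dp sf]].
apply: smooth_near_eq (smooth_near_comp (F := fun y => d (cinv c y)) _ _).
- by apply: filterS (local_expr_transition f dp cp) => x ->; exact: erefl.
- by move=> l; exact: transition_smooth.
- by rewrite chartK.
Qed.

Lemma smooth_at_near p f : smooth_at p f -> \forall q \near p, smooth_at q f.
Proof.
move=> [c [Ac cp sf]].
apply: filterS2 (chart_dom_near cp) (near_chartI cp (smooth_near_near sf)).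
by move=> q cq sq; exists c.
Qed.

Lemma local_expr_near c p f g : cdom c p -> (\forall q \near p, f q = g q) ->
  \forall x \near c p, local_expr c f x = local_expr c g x.
Proof. by move=> cp fg; exact: (near_chart cp fg). Qed.

Lemma local_expr_coord c p k : cdom c p ->
  \forall x \near c p, local_expr c (chart_coord c k) x = x 0 k.
Proof.
move=> cp; apply: filterS (chart_image_near cp) => x [_ E].
by rewrite /local_expr /chart_coord E.
Qed.

Lemma smooth_at_coord c p k : atlas c -> cdom c p -> smooth_at p (chart_coord c k).
Proof.
move=> Ac cp; exists c; split; [exact: Ac|exact: cp|].
apply: smooth_near_eq (smooth_near_coord (c p) k).
by apply: filterS (local_expr_coord k cp) => x <-.
Qed.

Lemma smooth_at_eq p f g : (\forall q \near p, f q = g q) -> smooth_at p f -> smooth_at p g.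
Proof.
move=> fg [c [Ac cp sf]]; exists c; split; [exact: Ac|exact: cp|].
by apply: smooth_near_eq sf; exact: (local_expr_near cp fg).
Qed.

Lemma smooth_atM p f g : smooth_at p f -> smooth_at p g ->
  smooth_at p (fun q => f q * g q).
Proof.
move=> [c [Ac cp sf]] sg; exists c; split; [exact: Ac|exact: cp|].
exact: smooth_nearM sf (smooth_at_chart Ac cp sg).
Qed.

Lemma smooth_at_sum p (F : 'I_n -> M -> R) : (exists2 c, atlas c & cdom c p) ->
  (forall k, smooth_at p (F k)) -> smooth_at p (fun q => \sum_(k < n) F k q).
Proof.
move=> [c Ac cp] sF; exists c; split; [exact: Ac|exact: cp|].
by apply: smooth_near_sum => k; exact: smooth_at_chart (sF k).
Qed.

Lemma smooth_at_coord_deriv c p f k : atlas c -> cdom c p -> smooth_at p f ->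
  smooth_at p (coord_deriv c k f).
Proof.
move=> Ac cp sf; exists c; split; [exact: Ac|exact: cp|].
apply: smooth_near_eq (smooth_near_partial k (smooth_at_chart Ac cp sf)).
by apply: filterS (chart_image_near cp) => x [_ E]; rewrite /coord_deriv E.
Qed.

Lemma coord_deriv_chain c d p f k : atlas c -> atlas d -> cdom c p -> cdom d p ->
  smooth_at p f -> coord_deriv d k f p =
    \sum_(l < n) coord_deriv d k (chart_coord c l) p * coord_deriv c l f p.
Proof.
move=> Ac Ad cp dp sf; rewrite {1}/coord_deriv.
rewrite (partial_near_eq k (local_expr_transition f cp dp)) partial_comp.
- by apply: eq_bigr => l _; rewrite chartK// mulrC.
- by move=> l; apply: smooth_near_differentiable; exact: transition_smooth.
- by rewrite chartK//; apply: smooth_near_differentiable; exact: smooth_at_chart.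
Qed.

(** Whatever chart [d] the definition of [vector_field] supplies, the chain rule shows that the
    components of [X] in [c] are its values on the coordinate functions of [c]. *)
Lemma vector_field_chart (U : set M) (X : operator M) c p :
  vector_field U X -> U p -> atlas c -> cdom c p ->
  (forall l, smooth_at p (X (chart_coord c l))) /\
  \forall q \near p, forall f, smooth_at q f ->
    X f q = \sum_(l < n) X (chart_coord c l) q * coord_deriv c l f q.
Proof.
move=> vX Up Ac cp; have [d [b [Ad dp sb Xb]]] := vX p Up.
have cd : \forall q \near p, cdom c q /\ cdom d q.
  by apply: filterI; exact: chart_dom_near.
split=> [l|].
  apply: (@smooth_at_eq _ (fun q =>
      \sum_(k < n) b k q * coord_deriv d k (chart_coord c l) q)).
    apply: filterS2 Xb cd => q Xq [cq _].
    by rewrite Xq//; exact: smooth_at_coord.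
  apply: smooth_at_sum => [|k]; first by exists c.
  apply: smooth_atM => //; apply: smooth_at_coord_deriv => //.
  exact: smooth_at_coord.
apply: filterS2 Xb cd => q Xq [cq dq] f sf.
rewrite Xq// (eq_bigr (fun k => \sum_(l < n)
   b k q * coord_deriv d k (chart_coord c l) q * coord_deriv c l f q)); last first.
  move=> k _; rewrite (coord_deriv_chain k Ac Ad cq dq sf) mulr_sumr.
  by apply: eq_bigr => l _; rewrite mulrA.
rewrite exchange_big /=; apply: eq_bigr => l _.
by rewrite -mulr_suml (Xq _ (smooth_at_coord l Ac cq)).
Qed.

End Charts.

(** * Words in the frame, read in a chart *)

Section FrameWords.
Variables (R : realType) (n : nat) (M : carnot_manifold R n).
Variables (U : set M) (X : 'I_n -> operator M) (c : chart R n M) (a : M).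
Local Notation V := 'rV[R]_n.
Hypotheses (vX : forall j, vector_field U (X j)) (Ua : U a).
Hypotheses (Ac : atlas c) (ca : cdom c a) (ca0 : c a = 0).

Definition frame_coef (i l : 'I_n) : V -> R := local_expr c (X i (chart_coord c l)).

Lemma smooth_frame_coef i l : smooth_near 0 (frame_coef i l).
Proof.
rewrite -ca0; apply: smooth_at_chart => //.
by have [+ _] := vector_field_chart (vX i) Ua Ac ca; exact.
Qed.

(** The induction carries smoothness along because the formula for [X i] holds on smooth functions
    only, and it needs equality near [0] rather than at [0] because the next letter differentiates
    again. *)
Lemma frame_word_local I (f : M -> R) : smooth_at a f ->
  smooth_at a (frame_word X I f) /\
  \forall x \near (0 : V),
    local_expr c (frame_word X I f) x = coef_word frame_coef I (local_expr c f) x.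
Proof.
move=> sf; elim: I => [|i I [sI EI]].
  by split => //; apply: near_all.
have [_ Xi] := vector_field_chart (vX i) Ua Ac ca.
have E : \forall x \near (0 : V), local_expr c (frame_word X (i :: I) f) x =
    coef_word frame_coef (i :: I) (local_expr c f) x.
  have [E1 E2] := (near_chart ca Xi, near_chart ca (smooth_at_near sI)).
  have E3 := chart_image_near ca.
  rewrite ca0 in E1 E2 E3.
  apply: filterS3 (filterI E1 E2) E3 (coef_field_near frame_coef i EI).
  move=> x [Ex sx] [cx xE] /= <-.
  rewrite {1}/local_expr /= (Ex _ sx); apply: eq_bigr => l _.
  by rewrite /coord_deriv xE.
split; last exact: E.
exists c; split; [exact: Ac|exact: ca|rewrite ca0].
apply: smooth_near_eq (smooth_coef_word smooth_frame_coef (i :: I) _).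
  by apply: filterS E => x Ex; exact: esym Ex.
by rewrite -ca0; exact: smooth_at_chart.
Qed.

Lemma frame_word_at I (f : M -> R) : smooth_at a f ->
  frame_word X I f a = coef_word frame_coef I (local_expr c f) 0.
Proof.
move=> /(frame_word_local I)[_ /nbhs_singleton <-].
by rewrite /local_expr -ca0 chartK.
Qed.

End FrameWords.

(** * Maps tangent to the identity *)

Lemma weight_gt0 (R : realType) (n : nat) (M : carnot_manifold R n) (j : 'I_n) :
  (0 < weight M j)%N.
Proof.
rewrite /weight big_nat_cond; elim/big_ind: _ => [|x y x0 y0|w /andP[/andP[]]//].
(* The default value of the minimum is the step, which is positive. *)
- by case: M.
- by rewrite leq_min x0.
Qed.

Section NearIdentity.
Variables (R : realType) (n : nat).
Local Notation V := 'rV[R]_n.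
Implicit Types phi : V -> V.

Lemma diffeo_near_smooth phi k : diffeo_near 0 phi ->
  smooth_near 0 (fun x => phi x 0 k).
Proof.
move=> [U [W [oU _ U0 [G [sphi _ _ _]]]]].
by exists U; split; [exact: oU|exact: U0|exact: sphi].
Qed.

Lemma tangent_to_id_id : tangent_to_id (id : V -> V).
Proof. by rewrite /tangent_to_id diff_val. Qed.

Lemma tangent_to_id_partial phi (j l : 'I_n) :
  (forall k, smooth_near 0 (fun x => phi x 0 k)) -> tangent_to_id phi ->
  partial j (fun x => phi x 0 l) 0 = (l == j)%:R.
Proof.
move=> sphi dphi.
have D : differentiable phi (0 : V).
  by apply: differentiable_row => k; exact: smooth_near_differentiable.
have E : 'D_(delta_mx 0 j) phi 0 = delta_mx 0 j by rewrite deriveE// dphi.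
have := derive_mx (diff_derivable (v := delta_mx 0 j) D).
by rewrite E => /(congr1 (fun A : V => A 0 l)); rewrite !mxE eqxx /= => H; exact: esym H.
Qed.

Variables (w : 'I_n -> nat) (N : V -> R).
Hypothesis w_gt0 : forall i, (0 < w i)%N.
Hypothesis hN : pseudo_norm w N.

Lemma dilation0 x : dilation w (0 : R) x = 0.
Proof.
by apply/rowP => i; rewrite !mxE expr0n gtn_eqF// mul0r.
Qed.

Lemma pseudo_norm0 : N 0 = 0.
Proof.
by case: hN => _ _ _ /(_ 0 0); rewrite dilation0 normr0 mul0r.
Qed.

(** The dilation with [t = 0] shows that [hat_phi] and [N] vanish at [0]; the neighbourhood in the
    estimate contains [0] itself, where the bound is zero. *)
Lemma admissible0 phi : admissible w N phi -> phi 0 = 0.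
Proof.
move=> [_ [hphi [_ _ hom _ O]]].
have h0 : hphi 0 = 0 by have := hom 0 0; rewrite !dilation0.
apply/rowP => k; have /eqO_exP[K K0 /nbhs_singleton] := O k.
rewrite pseudo_norm0 expr0n addn1 /= normr0 mulr0 normr_le0 h0 subr0.
by rewrite mxE => /eqP.
Qed.

(** On the curve [t |-> t.x], homogeneity makes the [k]-th component of [hat_phi] a multiple of
    [t ^+ w k], and the remainder is smaller by a further factor [t < 1]. *)
Lemma admissible_radial phi k : admissible w N phi -> forall x,
  exists C d : R, 0 < d /\
    forall t, 0 < t -> t < d -> `|phi (dilation w t x) 0 k| <= C * t ^+ w k.
Proof.
move=> [_ [hphi [_ _ hom _ O]]] x.
have /eqO_exP[K K0 HK] := O k.
have [d d0 Hd] := dilation_near0 w_gt0 x HK.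
exists (`|hphi x 0 k| + K * N x ^+ (w k + 1)), d; split => // t t0 td.
have [t1] := Hd t t0 td.
have [_ N0 _ NZ] := hN.
rewrite NZ (gtr0_norm t0) hom !mxE => Hb.
have -> : phi (dilation w t x) 0 k =
    t ^+ w k * hphi x 0 k + (phi (dilation w t x) 0 k - t ^+ w k * hphi x 0 k).
  by rewrite addrC subrK.
rewrite (le_trans (ler_normD _ _))// mulrDl lerD//.
  by rewrite normrM mulrC ler_wpM2l// ger0_norm// exprn_ge0// ltW.
apply: le_trans Hb _; rewrite exprMn normrM -mulrA ler_wpM2l ?(ltW K0)// mulrC.
rewrite !ger0_norm ?exprn_ge0 ?(ltW t0)//.
by rewrite ler_wpM2l ?exprn_ge0// exprD ler_piMr ?exprn_ge0 ?(ltW t0)// expr1 ltW.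
Qed.

Lemma admissible_id : admissible w N id.
Proof.
have sid : smooth_map_on setT (id : V -> V).
  by move=> k; apply/smooth_CkP => m; exact: Ck_coord.
have did := tangent_to_id_id.
split.
  exists setT, setT; split; [exact: openT|exact: openT|by []|].
  by exists id; split.
exists id; split => //; last first.
- move=> k; apply/eqO_exP; exists 1 => //; apply: (@near_all V (0 : V)) => x.
  by rewrite subrr mxE normr0 mul1r.
- by exists id; split.
(* Exponents in ['I_2] are [0] or [1]; component [k] has the single monomial with exponent [1] at
   [k] and [0] elsewhere. *)
exists 2, (fun k alpha => (alpha == [ffun i => if i == k then ord_max else ord0])%:R).
move=> x k; rewrite (bigD1 [ffun i => if i == k then ord_max else ord0])//= eqxx mul1r.
rewrite big1 ?addr0 => [|alpha /negbTE ->]; last by rewrite mul0r.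
rewrite /monomial (bigD1 k)//= ffunE eqxx /= big1 ?mulr1 ?expr1// => i /negbTE ik.
by rewrite ffunE ik.
Qed.

End NearIdentity.

(** * Privileged coordinates under a change of chart *)

Section Privileged.
Variables (R : realType) (n : nat) (M : carnot_manifold R n).
Variables (a : M) (U : set M) (X : 'I_n -> operator M).
Local Notation V := 'rV[R]_n.

(** Linear adaptedness says that the frame matrix at [a] is the identity and that [c a = 0], so the
    affine map is trivial, and the correction [hat_psi] can be taken with zero coefficients. *)
Lemma privileged_is_psi_id (c : chart R n M) : atlas c -> cdom c a ->
  privileged a X c -> is_psi a X c id.
Proof.
move=> Ac ca pc; have [[c0 lin] _] := pc.
exists 1%:M, id; split => //.
- move=> j f sf; rewrite lin// (bigD1 j)//= mxE eqxx mul1r big1 ?addr0// => k kj.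
  by rewrite mxE eq_sym (negbTE kj) mul0r.
- exists (fun _ _ => 0) => x k.
  by rewrite big1 ?addr0// => alpha _; rewrite mul0r.
- by move=> x; rewrite /affine_T c0 subr0 invmx1 mulmx1.
- by exists c; split => //; exact: near_all.
Qed.

Hypothesis hX : H_frame U X.
Hypothesis aU : U a.

(** The two charts have the same coordinate derivations at [a], because the chain rule relates them
    by the matrix of [phi'(0)]. *)
Lemma linearly_adapted_comp (c d : chart R n M) (phi : V -> V) :
  atlas c -> cdom c a -> atlas d -> cdom d a -> linearly_adapted a X c ->
  (forall k, smooth_near 0 (fun x => phi x 0 k)) -> phi 0 = 0 -> tangent_to_id phi ->
  (\forall p \near a, d p = phi (c p)) -> linearly_adapted a X d.
Proof.
move=> Ac ca Ad da [c0 lin] sphi phi0 dphi dE.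
have da0 : d a = 0 by rewrite (nbhs_singleton dE) c0.
split => // j f sf; rewrite lin// (coord_deriv_chain j Ad Ac da ca sf).
have pE l : coord_deriv c j (chart_coord d l) a = (l == j)%:R.
  rewrite -(tangent_to_id_partial j l sphi dphi) -c0; apply: partial_near_eq.
  apply: filterS2 (near_chart ca dE) (chart_image_near ca) => x Ex [_ cx].
  by rewrite /chart_coord Ex cx.
rewrite (bigD1 j)//= pE eqxx mul1r big1 ?addr0// => l /negbTE lj.
by rewrite pE lj mul0r.
Qed.

Lemma privileged_comp (N : V -> R) (c d : chart R n M) (phi : V -> V) :
  pseudo_norm (weight M) N ->
  atlas c -> cdom c a -> atlas d -> cdom d a -> privileged a X c ->
  admissible (weight M) N phi -> tangent_to_id phi ->
  (\forall p \near a, d p = phi (c p)) -> privileged a X d.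
Proof.
move=> hN Ac ca Ad da [linc ordc] adm dphi dE.
have w0 := weight_gt0 M; have phi0 := admissible0 w0 hN adm.
have sphi k := diffeo_near_smooth k adm.1.
have lind := linearly_adapted_comp Ac ca Ad da linc sphi phi0 dphi dE.
split=> // k; have c0 := linc.1.
have vX j : vector_field U (X j) by have [/(_ j) []] := hX.
have word := frame_word_at vX aU Ac ca c0.
have sbeta := smooth_frame_coef vX aU Ac ca c0.
have coord l : frame_order (weight M) (frame_coef X c) (weight M l) (fun x => x 0 l).
  have := local_expr_coord l ca; rewrite c0 => E.
  apply: (frame_order_eq E) => J Jl.
  rewrite -word; last exact: smooth_at_coord.
  have [ord _] := ordc l; exact: (ord J Jl).
split.
  move=> J Jk; rewrite word; last exact: smooth_at_coord.
  have E : \forall x \near (0 : V), phi x 0 k = local_expr c (chart_coord d k) x.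
    rewrite -c0; apply: filterS2 (near_chart ca dE) (chart_image_near ca).
    by move=> x Ex [_ cx]; rewrite /local_expr /chart_coord Ex cx.
  apply: (frame_order_eq E) Jk.
  apply: (radial_bound_frame_order w0 sbeta coord (sphi k)).
  exact: (admissible_radial w0 hN) adm.
exists [:: k]; first by rewrite /word_weight big_seq1.
rewrite /frame_word /= lind.2; last exact: smooth_at_coord.
rewrite /coord_deriv (partial_near_eq k (local_expr_coord k da)) partial_coord eqxx.
exact: oner_neq0.
Qed.

End Privileged.

Theorem corollary5p10 (R : realType) (n : nat) (M : carnot_manifold R n)
  (N : 'rV[R]_n -> R) (hN : pseudo_norm (weight M) N)
  (a : M) (U : set M) (hU : open U) (aU : U a)
  (X : 'I_n -> operator M) (hX : H_frame U X)
  (chi : chart R n M) (hchi : atlas chi) (achi : cdom chi a) :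
  privileged a X chi <->
  exists (kappa : chart R n M) (psi phi : 'rV[R]_n -> 'rV[R]_n),
    [/\ [/\ atlas kappa, cdom kappa a & kappa a = 0],
        is_psi a X kappa psi,
        admissible (weight M) N phi,
        tangent_to_id phi &
        \forall p \near a, chi p = phi (psi (kappa p))].
Proof.
split=> [pchi|[kappa [psi [phi [_ [B [hpsi [_ _ _ [c [Ac ca cE pc]]]]] adm dphi chiE]]]]].
  exists chi, id, id; split.
  - by split=> //; exact: pchi.1.1.
  - exact: privileged_is_psi_id.
  - exact: admissible_id.
  - exact: tangent_to_id_id.
  - exact: near_all.
(* [is_psi] provides a privileged chart [c] of the atlas that agrees with [psi \o kappa] near [a],
   so [chi] is [phi \o c] there. *)
apply: (privileged_comp hX aU hN Ac ca hchi achi pc adm dphi).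
by apply: filterS2 cE chiE => p -> ->.
Qed.
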